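(* There exists a separable strictly convex Banach space which is isometrically universal for all separable uniformly convex Banach spaces.
   Context: Banach spaces are real. A Banach space is strictly convex if its unit sphere contains no non-degenerate line segment. A Banach space $X$ is isometrically universal for a class $\mathcal{C}$ of Banach spaces if it contains an isometric copy of every member of $\mathcal{C}$, i.e. for every $Y\in\mathcal{C}$ there is a linear isometric embedding (not necessarily onto) of $Y$ into $X$. Uniform convexity refers to the given norm of the space. *)

(* Defs.v *)
From HB Require Import structures.
From mathcomp Require Import all_boot all_order all_algebra.
From mathcomp Require Import classical_sets functions cardinality reals.
From mathcomp Require Import topology normedtype.

Set Implicit Arguments.
Unset Strict Implicit.
Unset Printing Implicit Defensive.

Import Order.TTheory GRing.Theory Num.Theory.
Import numFieldNormedType.Exports.

Local Open Scope classical_set_scope.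
Local Open Scope ring_scope.

Definition separable (T : topologicalType) : Prop :=
  exists2 D : set T, countable D & dense D.

Definition unit_sphere (R : realType) (X : normedModType R) : set X :=
  [set x | `|x| = 1].

Definition segment (R : realType) (X : normedModType R) (x y : X) : set X :=
  [set (1 - t) *: x + t *: y | t in `[0, 1]%classic : set R].

Definition strictly_convex (R : realType) (X : normedModType R) : Prop :=
  forall x y : X, segment x y `<=` @unit_sphere R X -> x = y.

(* Values eps > 2 are harmless: no two unit vectors are that far apart. *)
Definition uniformly_convex (R : realType) (X : normedModType R) : Prop :=
  forall eps : R, 0 < eps -> exists2 delta : R, 0 < delta &
    forall x y : X, @unit_sphere R X x -> @unit_sphere R X y ->
      eps <= `|x - y| -> `|2^-1 *: (x + y)| <= 1 - delta.

Definition isometrically_embeds (R : realType) (Y X : normedModType R) : Prop :=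
  exists f : {linear Y -> X}, forall y : Y, `|f y| = `|y|.

Definition isometrically_universal (R : realType)
    (X : completeNormedModType R) (C : completeNormedModType R -> Prop) : Prop :=
  forall Y : completeNormedModType R, C Y -> isometrically_embeds Y X.

(* Main.v *)
Require Import Defs.
From HB Require Import structures.
From mathcomp Require Import all_boot all_order all_algebra.
From mathcomp Require Import boolp classical_sets functions cardinality reals.
From mathcomp Require Import topology normedtype.
From mathcomp Require Import ring lra zify.

(** A uniformly convex space $Y$ satisfies, besides its metric inequalities, a
countable list of linear ones which witness convexity.  If $f$ and $h$ are
functionals of norm at most $1$ and $\theta$ is at most the modulus of
convexity at $\varepsilon$, then $\|f+\theta h\|+\|f-\theta h\|\le
2+\theta\varepsilon$ ([smoothness]); conversely, if for given $h$ and
$\varepsilon$ one $\theta>0$ serves, up to another $\theta\varepsilon$,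
all members $f$ of a norming family, then no two unit vectors on which $h$
differs by more than $2\varepsilon$ have a midpoint of norm $1$
([coordinates_eq]).  So the convexity of $Y$ is recorded by countably many
natural numbers, a code.

Codes form an infinitely branching tree, and the universal space consists of
functions on its nodes.  A code $\tau$ of $Y$ is a branch, and $y$ is
represented on that branch by the values of a norming family of functionals;
at a node which leaves $\tau$ after $k$ letters one only sees a functional of
level $k$.  Arranging the functionals in a binary tree that is equicontinuous
at infinity ([functional_tree]) makes all these functions uniform limits of
functions depending on a finite truncation of the node.  The space of such
limits ([tame_fun]) is separable, although it contains the spaces of all the
uncountably many codes.

Its norm is a supremum over all codes $s$, of the supremum $\lambda_s$ of
$|x|$ along the branch of $s$ plus a weighted penalty for the inequalities
recorded in $s$ that $x$ violates; a further condition forces $x$ to be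
determined by its values on the branch.  Every penalized expression is a
combination of $\lambda_s$ and moduli of linear forms with nonnegative
coefficients, so it is a seminorm.

The norm is strictly convex.  Adding a letter at infinity makes the set of
codes compact, the expressions are upper semicontinuous in the code, and the
supremum is attained ([full_norm_attained]).  They carry an extra parameter
$r$, tending to $0$ along a sequence, in
$(1-r^2)\lambda_s+(1+r)\cdot\mathrm{penalty}+r^2h$ with $h$ strictly
convex.  If the maximum at the midpoint of a segment is attained with $r>0$,
then $h$ forces the ends to coincide. If it is attained with $r=0$ then the
penalty vanishes there, as otherwise a small $r>0$ would give more; then both
ends satisfy all inequalities recorded in $s$, and these make them equal
([full_norm_strict]).

The representation of $Y$ is isometric ([embed_isometry]).  On $\tau$ there
is no penalty. On a code that leaves $\tau$ after $k$ letters the functionals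
of level at most $k$, whose norms are at most $1-1/(k+1)$, leave a slack of
$\|y\|/(k+1)$, and this pays for the penalty, because an inequality not decided by the first
$k$ letters has weight at most $1/(16(k+1))$ ([excess_slack]). *)

Set Implicit Arguments.
Unset Strict Implicit.
Unset Printing Implicit Defensive.

Import Order.TTheory GRing.Theory Num.Theory.
Import numFieldNormedType.Exports.

Local Open Scope classical_set_scope.
Local Open Scope ring_scope.

(** * Suprema and seminorms *)

Section Suprema.
Context {R : realType}.

Definition supf (I : Type) (f : I -> R) : R := sup (range f).

Lemma le_supf (I : Type) (f : I -> R) c i : (forall j, f j <= c) -> f i <= supf f.
Proof.
by move=> fc; apply: ub_le_sup; [exists c => _ [j _ <-] | exists i].
Qed.

Lemma supf_le (I : Type) (i : I) (f : I -> R) c :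
  (forall j, f j <= c) -> supf f <= c.
Proof. by move=> fc; apply: ge_sup; [exists (f i), i | move=> _ [j _ <-]]. Qed.

Lemma supf_gt (I : Type) (i : I) (f : I -> R) c :
  c < supf f -> exists j, c < f j.
Proof.
move=> cf; apply: contrapT => /forallNP fc; move: cf; apply/negP.
by rewrite -leNgt (supf_le i)// => j; rewrite leNgt; apply/negP.
Qed.

Definition seminorm (V : lmodType R) (p : V -> R) : Prop :=
  (forall x y, p (x + y) <= p x + p y) /\ (forall a x, p (a *: x) = `|a| * p x).

Section SeminormTheory.
Variable V : lmodType R.
Implicit Types (p q : V -> R) (x y : V).

Lemma seminorm0 p : seminorm p -> p 0 = 0.
Proof. by case=> _ /(_ 0 0); rewrite scale0r normr0 mul0r. Qed.

Lemma seminormN p x : seminorm p -> p (- x) = p x.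
Proof. by case=> _ /(_ (-1) x); rewrite scaleN1r normrN1 mul1r. Qed.

Lemma seminorm_ge0 p x : seminorm p -> 0 <= p x.
Proof.
move=> sp; have := sp.1 x (- x).
by rewrite subrr (seminorm0 sp) (seminormN _ sp) => h; lra.
Qed.

Lemma seminorm_mid p x y : seminorm p -> 2 * p (2^-1 *: (x + y)) <= p x + p y.
Proof.
move=> sp; rewrite sp.2 ger0_norm ?invr_ge0//.
by have := sp.1 x y; lra.
Qed.

(** The opposite homogeneity inequality follows by rescaling back with the
    inverse scalar. *)
Lemma seminorm_intro p : (forall x y, p (x + y) <= p x + p y) ->
  (forall a x, p (a *: x) <= `|a| * p x) -> seminorm p.
Proof.
move=> pD pZ; split=> // a x; apply/eqP; rewrite eq_le pZ /=.
have [->|a0] := eqVneq a 0.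
  rewrite normr0 mul0r.
  by have := pD 0 (0 *: x); rewrite scale0r addr0 => h; lra.
have := pZ a^-1 (a *: x).
by rewrite scalerA mulVf// scale1r normfV ler_pdivlMl // normr_gt0.
Qed.

Lemma seminormD p q : seminorm p -> seminorm q -> seminorm (fun x => p x + q x).
Proof.
move=> [pD pZ] [qD qZ]; split=> [x y|a x]; last by rewrite pZ qZ mulrDr.
by have := pD x y; have := qD x y; lra.
Qed.

Lemma seminormM p a : 0 <= a -> seminorm p -> seminorm (fun x => a * p x).
Proof.
move=> a0 [pD pZ]; split=> [x y|b x]; last by rewrite pZ mulrCA.
by rewrite -mulrDr ler_wpM2l.
Qed.

Lemma seminorm_sup (I : Type) (i : I) (p : I -> V -> R) (b : V -> R) :
  (forall i, seminorm (p i)) -> (forall i x, p i x <= b x) ->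
  seminorm (fun x => supf (p^~ x)).
Proof.
move=> sp pb; have ub j x : p j x <= supf (p^~ x).
  exact: (@le_supf _ (p^~ x) (b x)).
apply: seminorm_intro => [x y|a x]; apply: (supf_le i) => j.
  by have := (sp j).1 x y; have := ub j x; have := ub j y; lra.
by rewrite (sp j).2 ler_wpM2l.
Qed.

End SeminormTheory.
End Suprema.

(** * Norming functionals *)

Section HahnBanach.
Context {R : realType} (Y : lmodType R).
Implicit Types (x y : Y).

Definition sublinear (p : Y -> R) : Prop :=
  (forall x y, p (x + y) <= p x + p y) /\
  (forall a x, 0 <= a -> p (a *: x) = a * p x).

Lemma sublinear0 p : sublinear p -> p 0 = 0.
Proof. by case=> _ /(_ 0 0); rewrite scale0r mul0r; apply. Qed.

Lemma sublinear_geN p x : sublinear p -> - p (- x) <= p x.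
Proof.
by move=> sp; have := sp.1 x (- x); rewrite subrr (sublinear0 sp); lra.
Qed.

(** The sublinear minorant of [p] obtained by pushing [p] down in the
    direction [- y] as far as sublinearity permits: it takes the value at most
    [- p y] at [- y]. *)
Definition slide (p : Y -> R) y x : R := inf [set p (x + t *: y) - t * p y | t in [set t | 0 <= t]].

Lemma slide_le p y x t : sublinear p -> 0 <= t ->
  slide p y x <= p (x + t *: y) - t * p y.
Proof.
move=> sp t0; apply: ge_inf; last by exists t.
exists (- p (- x)) => _ [s /= s0 <-].
have := sp.1 (x + s *: y) (- x).
by rewrite addrAC subrr add0r sp.2//; lra.
Qed.

Lemma le_slide p y x c : (forall t, 0 <= t -> c <= p (x + t *: y) - t * p y) ->
  c <= slide p y x.
Proof.
move=> h; apply: lb_le_inf; first by exists (p (x + 0 *: y) - 0 * p y), 0 => /=.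
by move=> _ [t /= t0 <-]; exact: h.
Qed.

Lemma slide_sublinear p y : sublinear p -> sublinear (slide p y).
Proof.
move=> sp; split=> [x z|a x].
  rewrite -lerBlDr; apply: le_slide => t t0.
  rewrite lerBlDr -lerBlDl; apply: le_slide => s s0.
  rewrite lerBlDl (le_trans (slide_le _ _ sp (addr_ge0 t0 s0)))//.
  have := sp.1 (x + t *: y) (z + s *: y).
  by rewrite addrACA -scalerDl; lra.
rewrite le_eqVlt => /predU1P[<-|a0].
  rewrite scale0r mul0r; apply/eqP; rewrite eq_le; apply/andP; split.
    by apply: (le_trans (slide_le _ _ sp (lexx 0))); rewrite scale0r mul0r addr0 subr0 sublinear0.
  by apply: le_slide => t t0; rewrite add0r sp.2// subrr.
apply/eqP; rewrite eq_le; apply/andP; split.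
  rewrite -ler_pdivrMl//; apply: le_slide => t t0.
  rewrite ler_pdivrMl// (le_trans (slide_le _ _ sp (mulr_ge0 (ltW a0) t0)))//.
  rewrite -scalerA -scalerDr sp.2 ?(ltW a0)//.
  by rewrite mulrBr mulrA.
apply: le_slide => t t0.
have ta : 0 <= a^-1 * t by rewrite mulr_ge0// invr_ge0 ltW.
rewrite -ler_pdivlMl// (le_trans (slide_le _ _ sp ta))//.
rewrite mulrBr mulrA lerD2r -sp.2 ?invr_ge0 ?(ltW a0)//.
by rewrite scalerDr !scalerA mulVf ?gt_eqF// scale1r.
Qed.

(** The pointwise infimum of a chain of sublinear functionals is sublinear, so
    Zorn applies. *)
Lemma minimal_sublinear q : sublinear q ->
  exists2 p, sublinear p /\ (forall x, p x <= q x) &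
    forall p', sublinear p' -> (forall x, p' x <= p x) -> p' = p.
Proof.
move=> sq.
pose T := {p : Y -> R | sublinear p /\ (forall x, p x <= q x)}.
pose rel (p p' : T) := `[< forall x, sval p' x <= sval p x >].
have [||||p pmin] := @Zorn T rel.
- by move=> p; apply/asboolP.
- move=> p1 p2 p3 /asboolP h1 /asboolP h2; apply/asboolP => x.
  exact: le_trans (h2 x) (h1 x).
- move=> p1 p2 /asboolP h1 /asboolP h2.
  have : sval p1 = sval p2 by apply/funext => x; apply/eqP; rewrite eq_le h1 h2.
  case: p1 p2 {h1 h2} => [f1 h1] [f2 h2] /= e.
  by case: _ / e h2 => h2; congr exist; exact: Prop_irrelevance.
- move=> A Atot.
  have [A0|A0] := pselect (exists p : T, A p); last first.
    exists (exist _ q (conj sq (fun x => lexx (q x)))) => s As.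
    by case: A0; exists s.
  pose m x := inf [set sval p x | p in A].
  have mle p x : A p -> m x <= sval p x.
    move=> Ap; apply: ge_inf; last by exists p.
    exists (- q (- x)) => _ [p' Ap' <-].
    have [sp' pq'] := svalP p'.
    by have := sublinear_geN x sp'; have := pq' (- x); lra.
  have glb x c : (forall p, A p -> c <= sval p x) -> c <= m x.
    move=> h; apply: lb_le_inf; first by case: A0 => p Ap; exists (sval p x), p.
    by move=> _ [p Ap <-]; exact: h.
  have sm : sublinear m.
    split=> [x y|a x a0].
      rewrite -lerBlDr; apply: (glb _) => p Ap.
      rewrite lerBlDr -lerBlDl; apply: (glb _) => p1 Ap1.
      rewrite lerBlDl.
      have [sp _] := svalP p; have [sp1 _] := svalP p1.
      have [/asboolP le|/asboolP le] := Atot _ _ Ap Ap1.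
        apply: (le_trans (mle _ _ Ap1)); apply: (le_trans (sp1.1 _ _)).
        by rewrite lerD2r.
      apply: (le_trans (mle _ _ Ap)); apply: (le_trans (sp.1 _ _)).
      by rewrite lerD2l.
    move: a0; rewrite le_eqVlt => /predU1P[<-|a0].
      rewrite scale0r mul0r; case: A0 => p0 Ap0; apply/eqP; rewrite eq_le.
      rewrite -{1}(sublinear0 (svalP p0).1) mle//=.
      by apply: (glb _) => p _; rewrite (sublinear0 (svalP p).1).
    apply/eqP; rewrite eq_le; apply/andP; split.
      rewrite -ler_pdivrMl//; apply: (glb _) => p Ap; rewrite ler_pdivrMl//.
      by rewrite -(svalP p).1.2 ?(ltW a0)// mle.
    apply: (glb _) => p Ap; rewrite (svalP p).1.2 ?(ltW a0)// ler_pM2l//.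
    exact: mle.
  have mq x : m x <= q x.
    by case: A0 => p Ap; apply: (le_trans (mle p x Ap)); have [_] := svalP p; apply.
  by exists (exist _ m (conj sm mq)) => s As; apply/asboolP => x; exact: mle.
exists (sval p); first exact: (svalP p).
move=> p' sp' p'p.
have p'q x : p' x <= q x by apply: (le_trans (p'p x)); have [_] := svalP p; apply.
have rp : rel p (exist _ p' (conj sp' p'q)) by apply/asboolP.
exact: (congr1 sval (pmin _ rp)).
Qed.

(** A minimal sublinear functional equals all of its slides, hence is odd and
    therefore linear. Starting below the slide of [q] along [y] gives the
    lower bound at [y]. *)
Lemma dominated_linear q y : sublinear q ->
  exists2 f : Y -> R, linear f & (forall x, f x <= q x) /\ q y <= f y.
Proof.
move=> sq; have [f [sf fq] fmin] := minimal_sublinear (slide_sublinear y sq).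
have fN x : f (- x) = - f x.
  have slf z : slide f x z <= f z.
    apply: (le_trans (slide_le _ _ sf (lexx 0))).
    by rewrite scale0r mul0r addr0 subr0.
  have /(congr1 (@^~ (- x))) /= := fmin _ (slide_sublinear x sf) slf.
  have := slide_le x (- x) sf ler01.
  rewrite scale1r mul1r addNr (sublinear0 sf) => h1 h2.
  by have := sublinear_geN x sf; lra.
have fZ a x : f (a *: x) = a * f x.
  have [a0|a0] := leP 0 a; first by rewrite sf.2.
  apply: oppr_inj; rewrite -fN -scaleNr sf.2 ?mulNr//.
  by rewrite oppr_ge0 ltW.
have fD x z : f (x + z) = f x + f z.
  apply/eqP; rewrite eq_le sf.1 /=.
  by have := sf.1 (- x) (- z); rewrite -opprD !fN; lra.
have sqq x : slide q y x <= q x.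
  apply: (le_trans (slide_le _ _ sq (lexx 0))).
  by rewrite scale0r mul0r addr0 subr0.
exists f; first by move=> a x z; rewrite fD fZ.
split=> [x|]; first exact: le_trans (fq x) (sqq x).
have := fq (- y); have := slide_le y (- y) sq ler01.
by rewrite scale1r mul1r addNr (sublinear0 sq) fN; lra.
Qed.

End HahnBanach.

Definition unit_functional (R : realType) (Y : normedModType R) (f : Y -> R) : Prop :=
  linear f /\ forall y, `|f y| <= `|y|.

Lemma norming_functional (R : realType) (Y : normedModType R) (y : Y) :
  exists2 f : Y -> R, unit_functional f & f y = `|y|.
Proof.
have [|f lf [fle fy]] := @dominated_linear R Y Num.norm y.
  by split=> [|a x a0]; [exact: ler_normD | rewrite normrZ ger0_norm].
have fN x : f (- x) = - f x.
  have f0 : f 0 = 0 by have := lf 1 0 0; rewrite scaler0 addr0 scale1r => h; lra.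
  by have := lf (-1) x 0; rewrite f0 !addr0 !scaleN1r.
exists f; last by apply/eqP; rewrite eq_le fle.
split=> // x; rewrite ler_norml fle andbT.
by have := fle (- x); rewrite fN normrN; lra.
Qed.

(** * A tree of functionals on a separable space *)

Lemma dense_sequence (R : realType) (Y : normedModType R) : separable Y ->
  exists y_ : nat -> Y, forall (y : Y) (e : R), 0 < e -> exists j, `|y - y_ j| < e.
Proof.
move=> [D /countable_injP[h hinj] Ddense].
exists (fun j => xget 0 (D `&` [set y | h y = j])) => y e e0.
have [||z [/interior_subset bz Dz]] := Ddense (ball y e)^°.
- by exists y; exact: nbhsx_ballx.
- exact: open_interior.
exists (h z) => /=; case: xgetP => [w _ [Dw hw]|/(_ z)]; last by case; split.
suff -> : w = z by rewrite -ball_normE in bz.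
by apply: hinj => //; exact: mem_set.
Qed.

Section FunctionalTree.
Context {R : realType} (Y : normedModType R).
Implicit Types (f : Y -> R) (u : seq bool).

Lemma unit_functionalB f x y : unit_functional f -> f (x - y) = f x - f y.
Proof.
by move=> [lf _]; rewrite addrC -scaleN1r lf scaleN1r addrC.
Qed.

Lemma unit_functional0 : unit_functional (fun _ : Y => 0 : R).
Proof. by split=> [a x y|y]; rewrite ?scaler0 ?addr0 ?normr0. Qed.

Variable y_ : nat -> Y.
Hypothesis y_dense : forall (y : Y) (e : R), 0 < e -> exists j, `|y - y_ j| < e.

(** The tests compare the value at a point of the dense sequence with a
    rational number; a functional is determined by the outcomes of all of
    them. *)
Definition bit_test f (l : nat) : bool :=
  if @unpickle (nat * int * nat)%type l is Some (j, i, n)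
  then f (y_ j) < i%:~R / n.+1%:R else false.

Definition cell u f : Prop :=
  unit_functional f /\ forall l, (l < size u)%N -> bit_test f l = nth false u l.

Lemma cell_take k u f : cell u f -> cell (take k u) f.
Proof.
move=> [uf fu]; split=> // l; rewrite size_take_min leq_min => /andP[lk lu].
by rewrite nth_take// fu.
Qed.

(** Two values at [y_ j] further apart than [e] are separated by a point of a
    grid of mesh less than [e]; only finitely many grid points lie in the
    range allowed by the norm of [y_ j], so a long enough list of tests
    contains all of them. *)
Lemma cell_diam_seq j (e : R) : 0 < e -> exists d, forall u f f', (d <= size u)%N ->
  cell u f -> cell u f' -> f (y_ j) <= f' (y_ j) + e.
Proof.
move=> e0; pose n := Num.truncn e^-1.
have ne : n.+1%:R^-1 < e.
  by rewrite invf_plt ?posrE// truncnS_gt.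
pose B := (Num.truncn (`|y_ j| * n.+1%:R)).+1.
pose d := (\max_(k < B.*2.+2) (pickle (j, (k%:Z - B%:Z - 1)%R, n))).+1.
exists d => u f f' du [uf fu] [uf' fu']; rewrite leNgt; apply/negP => ff'.
(* the grid point i / n.+1 lies in the interval from f' (y_ j) to f (y_ j) *)
pose i := Num.floor (f (y_ j) * n.+1%:R).
have n0 : (0 : R) < n.+1%:R by rewrite ltr0n.
have ile : i%:~R <= f (y_ j) * n.+1%:R := floor_le _.
have ilt : f (y_ j) * n.+1%:R < (i + 1)%:~R := floorD1_gt _.
have fB : `|f (y_ j) * n.+1%:R| < B%:R.
  rewrite normrM (ger0_norm (ltW n0)) (le_lt_trans _ (truncnS_gt _))//.
  by rewrite ler_pM2r//; exact: uf.2.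
have /andP[iB1 iB2] : (- B%:Z - 1 <= i)%R && (i <= B%:Z)%R.
  move: fB; rewrite ltr_norml => /andP[b1 b2].
  have h1 : (- B%:Z < i + 1)%R by rewrite -(ltr_int R) intrN; apply: lt_trans ilt.
  have h2 : (i < B%:Z)%R by rewrite -(ltr_int R); apply: le_lt_trans b2.
  by apply/andP; split; lia.
have [k ki kB] : exists2 k : nat, i = k%:Z - B%:Z - 1 & (k < B.*2.+2)%N.
  by exists `|(i + B%:Z + 1)%R|%N; lia.
have ld : (pickle (j, i, n) < size u)%N.
  by rewrite (leq_trans _ du)// ltnS ki (leq_bigmax (Ordinal kB)).
have := fu _ ld; rewrite -(fu' _ ld) /bit_test pickleK.
rewrite ltr_pdivlMr// ltNge ile /= => /esym/negbT.
rewrite -leNgt ler_pdivrMr// => iw.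
have : f (y_ j) * n.+1%:R > f' (y_ j) * n.+1%:R + 1.
  rewrite (le_lt_trans _ (_ : (f' (y_ j) + n.+1%:R^-1) * n.+1%:R < _))//.
    by rewrite mulrDl mulVf// gt_eqF.
  by rewrite ltr_pM2r// (le_lt_trans _ ff')// lerD2l ltW.
by move: ilt; rewrite intrD; lra.
Qed.

Lemma cell_diam (y : Y) (e : R) : 0 < e -> exists d, forall u f f', (d <= size u)%N ->
  cell u f -> cell u f' -> `|f y - f' y| <= e.
Proof.
move=> e0; have e3 : 0 < e / 3 by rewrite divr_gt0.
have [j yj] := y_dense y e3; have [d dP] := cell_diam_seq j e3.
exists d => u f f' du uf uf'.
have h1 := dP _ _ _ du uf uf'; have h2 := dP _ _ _ du uf' uf.
have b g : unit_functional g -> `|g y - g (y_ j)| <= e / 3.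
  by move=> ug; rewrite -unit_functionalB// (le_trans (ug.2 _))// ltW.
have := b _ uf.1; have := b _ uf'.1.
rewrite !ler_norml => /andP[a1 a2] /andP[a3 a4]; apply/andP; split; lra.
Qed.

Definition inhabited u : bool := `[< exists f, cell u f >].

(** The length of the longest prefix of [u] whose cell is not empty. Emptiness
    of cells is inherited by longer addresses. *)
Definition reach u : nat := \max_(n < (size u).+1 | inhabited (take n u)) n.

Lemma reach_le u : (reach u <= size u)%N.
Proof. by apply/bigmax_leqP => i _; rewrite -ltnS. Qed.

Lemma le_reach u n : (n <= size u)%N -> (exists f, cell (take n u) f) ->
  (n <= reach u)%N.
Proof.
rewrite -ltnS => nu /asboolP ex.
exact: (@leq_bigmax_cond _ _ (fun i => nat_of_ord i) (Ordinal nu)).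
Qed.

Lemma cell0 : cell [::] (fun _ => 0).
Proof. by split=> //; exact: unit_functional0. Qed.

Lemma inhabited0 : inhabited [::].
Proof. by apply/asboolP; exists (fun _ => 0); exact: cell0. Qed.

Lemma reachP u : exists f, cell (take (reach u) u) f.
Proof.
have [|i ei iE] := @eq_bigmax_cond _
  [pred n : 'I_(size u).+1 | inhabited (take n u)] (fun n => n : nat).
  by apply/card_gt0P; exists ord0; rewrite unfold_in /= take0 inhabited0.
have -> : reach u = i by rewrite -iE; apply: eq_bigl.
by move: ei; rewrite unfold_in => /asboolP.
Qed.

Lemma reach_take u k : (k <= size u)%N -> reach (take k u) = minn k (reach u).
Proof.
move=> ku; have sk : size (take k u) = k by rewrite size_takel.
apply/eqP; rewrite eqn_leq leq_min; apply/andP; split; first (apply/andP; split).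
- by rewrite -[X in (_ <= X)%N]sk reach_le.
- apply: le_reach.
    by rewrite (leq_trans (reach_le _))// sk.
  have [f] := reachP (take k u); rewrite take_takel ?(leq_trans (reach_le _)) ?sk//.
  by exists f.
- apply: le_reach; first by rewrite sk geq_minl.
  have [f cf] := reachP u; exists f; rewrite take_takel ?geq_minl//.
  by rewrite take_min; exact: cell_take.
Qed.

Definition pick_functional u : Y -> R := xget (fun _ => 0) (cell u).

(** An address with an empty cell gets the functional of its longest prefix
    with a nonempty one, so that every address has a functional and prefixes
    still approximate. *)
Definition functional_at u : Y -> R := pick_functional (take (reach u) u).

Lemma functional_at_cell u : cell (take (reach u) u) (functional_at u).
Proof.
rewrite /functional_at /pick_functional.
by case: xgetP => // H; have [f /H] := reachP u.
Qed.

Lemma functional_at_unit u : unit_functional (functional_at u).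
Proof. by case: (functional_at_cell u). Qed.

Lemma functional_at_cauchy y (e : R) : 0 < e -> exists d, forall u k,
  (d <= k)%N -> `|functional_at u y - functional_at (take k u) y| <= e.
Proof.
move=> e0; have [d dP] := cell_diam y e0; exists d => u k dk.
have [uk|/ltnW ku] := leqP (size u) k.
  by rewrite take_oversize// subrr normr0 ltW.
have [kr|/ltnW rk] := leqP k (reach u).
  apply: (dP (take k u)); first by rewrite size_takel.
    have := cell_take k (functional_at_cell u).
    by rewrite take_takel.
  have := functional_at_cell (take k u).
  by rewrite reach_take// (minn_idPl kr) take_takel.
rewrite [functional_at (take k u)]/functional_at reach_take// (minn_idPr rk).
by rewrite take_takel// subrr normr0 ltW.
Qed.

Lemma functional_at_norming y (e : R) m : 0 < e ->
  exists2 u, (m <= size u)%N & `|y| - e <= `|functional_at u y|.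
Proof.
move=> e0; have [f uf fy] := norming_functional y.
have [d dP] := cell_diam y e0.
pose u := mkseq (bit_test f) (maxn d m).
have uf' : cell u f.
  by split=> // l; rewrite size_mkseq => ld; rewrite nth_mkseq.
have ru : reach u = size u.
  apply/eqP; rewrite eqn_leq reach_le le_reach//.
  by exists f; rewrite take_size.
have := functional_at_cell u; rewrite ru take_size => cu.
exists u; first by rewrite size_mkseq leq_maxr.
have := dP u _ _ _ uf' cu; rewrite size_mkseq leq_maxl fy => /(_ isT).
rewrite ler_norml => /andP[a1 a2].
by have := ler_norm (functional_at u y); lra.
Qed.

End FunctionalTree.

(** The loss of norm imposed at level [k]; the same sequence also serves as
    the list of tolerances, of step sizes and of clause weights. *)
Definition damp (R : realType) (k : nat) : R := k.+1%:R^-1.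

Lemma damp_gt0 (R : realType) k : 0 < damp R k.
Proof. by rewrite invr_gt0. Qed.

Lemma damp_le1 (R : realType) k : damp R k <= 1.
Proof. by rewrite invf_le1// ler1n. Qed.

Lemma damp_le (R : realType) k l : (k <= l)%N -> damp R l <= damp R k.
Proof. by move=> kl; rewrite lef_pV2 ?posrE// ler_nat. Qed.

Lemma damp_small (R : realType) (e : R) : 0 < e -> exists k, damp R k <= e.
Proof.
move=> e0; exists (Num.truncn e^-1); rewrite /damp invf_ple ?posrE// ltW//.
exact: truncnS_gt.
Qed.

(** The last field is what lets a function on nodes forget the far part of an
    address; the damping provides the slack that pays for penalties. *)
Record functional_tree (R : realType) (Y : normedModType R)
    (g : seq bool -> Y -> R) : Prop := {
  tree_linear : forall u, linear (g u);
  tree_damped : forall u y, `|g u y| <= (1 - damp R (size u)) * `|y|;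
  tree_norming : forall y (e : R), 0 < e -> exists u, `|y| - e <= `|g u y|;
  tree_cauchy : forall y (e : R), 0 < e -> exists d, forall u k,
    (d <= k)%N -> `|g u y - g (take k u) y| <= e }.

(** Scaling by [1 - damp R k] at level [k] keeps the family norming because
    addresses may be taken arbitrarily long. *)
Lemma functional_tree_exists (R : realType) (Y : normedModType R) :
  separable Y -> exists g : seq bool -> Y -> R, functional_tree g.
Proof.
move=> /dense_sequence[y_ yd]; pose f := functional_at y_.
have uf u : unit_functional (f u) := functional_at_unit y_ u.
exists (fun u y => (1 - damp R (size u)) * f u y).
have d0 k : 0 <= 1 - damp R k by rewrite subr_ge0 damp_le1.
have small (y : Y) (e : R) : 0 < e -> exists k, forall l, (k <= l)%N -> damp R l * `|y| <= e.
  move=> e0; have y1 : 0 < `|y| + 1 by rewrite ltr_wpDl.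
  have [|k ke] := @damp_small R (e / (`|y| + 1)); first by rewrite divr_gt0.
  exists k => l /(damp_le R) lk; move: (le_trans lk ke); rewrite ler_pdivlMr// => h.
  by rewrite (le_trans _ h)// ler_pM2l ?damp_gt0// lerDl.
split.
- by move=> u a x y; rewrite (uf u).1 mulrDr; congr (_ + _); exact: mulrCA.
- by move=> u y; rewrite normrM (ger0_norm (d0 _)) ler_wpM2l// (uf u).2.
- move=> y e e0; have e2 : 0 < e / 2 by rewrite divr_gt0.
  have [k kP] := small y _ e2.
  have [u ku fu] := functional_at_norming yd y k e2.
  exists u; rewrite normrM (ger0_norm (d0 _)) mulrBl mul1r.
  have := kP _ ku; have := ler_wpM2l (ltW (damp_gt0 R (size u))) ((uf u).2 y).
  by move: fu; rewrite -/f; lra.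
- move=> y e e0; have e2 : 0 < e / 2 by rewrite divr_gt0.
  have [k kP] := small y _ e2.
  have [d dP] := functional_at_cauchy yd y e2.
  exists (maxn d k) => u l; rewrite geq_max => /andP[dl kl].
  have [ul|/ltnW lu] := leqP (size u) l.
    by rewrite take_oversize// subrr normr0 ltW.
  have := dP u l dl; rewrite -/f size_takel//.
  have dlu : damp R (size u) <= damp R l := damp_le R lu.
  have := ler_wpM2l (d0 l) (dP u l dl); have := (uf u).2 y; have := kP l kl.
  rewrite -/f; set a := f u y; set b := f _ y => h1 h2 h3 h4.
  have -> : (1 - damp R (size u)) * a - (1 - damp R l) * b =
    (1 - damp R l) * (a - b) + (damp R l - damp R (size u)) * a by ring.
  rewrite (le_trans (ler_normD _ _))// !normrM (ger0_norm (d0 l)).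
  rewrite [`|damp R l - _|]ger0_norm ?subr_ge0//.
  have : (damp R l - damp R (size u)) * `|a| <= damp R l * `|y|.
    rewrite ler_pM// ?subr_ge0//.
    by rewrite lerBlDr lerDl ltW// damp_gt0.
  have : (1 - damp R l) * (e / 2) <= e / 2.
    by rewrite ger_pMl// lerBlDr lerDl ltW// damp_gt0.
  by lra.
Qed.

(** * Nodes, codes and truncation *)

(** [None] is the point at infinity of the compactified alphabet. *)
Definition letter := option nat.

(** A node carries a finite word of letters and, along with it, the address of
    a functional. *)
Definition node := seq (letter * bool).

Definition code := nat -> letter.

Definition ctail (s : code) : code := fun i => s i.+1.

Definition clip K (a : letter) : letter :=
  if a is Some i then if (i < K)%N then a else None else None.

Definition trunc K (t : node) : node := [seq (clip K p.1, p.2) | p <- take K t].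

Fixpoint branch (s : code) (v : seq bool) : node :=
  if v is b :: v' then (s 0%N, b) :: branch (ctail s) v' else [::].

(** The letter [None] never counts as an agreement, so that [meet] does not
    change when a letter of the code escapes to infinity. *)
Fixpoint meet (s : code) (t : node) : nat :=
  if t is (a, _) :: t' then
    if (a != None) && (a == s 0%N) then (meet (ctail s) t').+1 else 0%N
  else 0%N.

Definition near_letter K (a a' : letter) : Prop := a' = a \/ a = None /\ clip K a' = None.

(** The code [s'] lies in the basic neighbourhood of [s] given by [K], for the
    product topology on words over the compactified alphabet. *)
Definition near_code K (s s' : code) : Prop := forall i, (i < K)%N -> near_letter K (s i) (s' i).

Section Nodes.
Implicit Types (s : code) (t : node) (v : seq bool).

Lemma clip_clip K L a : clip K (clip L a) = clip (minn K L) a.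
Proof.
case: a => //= i; rewrite leq_min.
by case: (i < L)%N; rewrite /= ?andbT ?andbF //.
Qed.

Lemma trunc_trunc K L t : trunc K (trunc L t) = trunc (minn K L) t.
Proof.
rewrite /trunc -map_take -map_comp take_min; apply: eq_map => -[a b] /=.
by rewrite clip_clip.
Qed.

Lemma branch_bits s v : unzip2 (branch s v) = v.
Proof. by elim: v s => //= b v IH s; rewrite IH. Qed.

Lemma take_branch s v k : take k (branch s v) = branch s (take k v).
Proof. by elim: v s k => [|b v IH] s [|k] //=; rewrite IH. Qed.

Lemma eq_branch s s' v : (forall i, (i < size v)%N -> s i = s' i) ->
  branch s v = branch s' v.
Proof.
elim: v s s' => //= b v IH s s' ss'; rewrite ss'//; congr cons.
by apply: IH => i iv; exact: ss'.
Qed.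

Lemma map_branch s v (h : letter -> letter) :
  [seq (h p.1, p.2) | p <- branch s v] = branch (h \o s) v.
Proof. by elim: v s => //= b v IH s; rewrite IH. Qed.

Lemma trunc_branch K s v : trunc K (branch s v) = branch (clip K \o s) (take K v).
Proof. by rewrite /trunc take_branch map_branch. Qed.

Lemma near_clip K a a' : near_letter K a a' -> clip K a' = clip K a.
Proof. by case=> [->|[->]]. Qed.

Lemma trunc_branch_nearby K s s' v : near_code K s s' ->
  trunc K (branch s' v) = trunc K (branch s v).
Proof.
move=> ss'; rewrite !trunc_branch; apply: eq_branch => i iv /=.
apply: near_clip; apply: ss'; apply: leq_trans iv _.
by rewrite size_take_min geq_minl.
Qed.

Lemma meet_le s t : (meet s t <= size t)%N.
Proof. by elim: t s => //= -[a b] t IH s; case: ifP => // _; rewrite ltnS. Qed.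

Lemma take_meet s t : take (meet s t) t = branch s (take (meet s t) (unzip2 t)).
Proof.
elim: t s => //= -[a b] t IH s; case: ifP => //= /andP[_ /eqP ->].
by rewrite IH.
Qed.

Lemma meet_nearby K s s' t : (size t <= K)%N -> near_code K s s' ->
  all (fun p => p.1 == clip K p.1) t -> meet s' t = meet s t.
Proof.
move=> tK ss'; have {ss'} : forall i, (i < size t)%N -> near_letter K (s i) (s' i).
  by move=> i it; apply: ss'; exact: leq_trans it tK.
elim: t s s' {tK} => //= -[a b] t IH s s' ss' /andP[/= /eqP aK tK].
have -> : ((a != None) && (a == s' 0%N)) = ((a != None) && (a == s 0%N)).
  case: (ss' 0%N isT) => [->//|[-> cK]].
  by case: eqP => //= a0; case: (eqVneq a (s' 0%N)) => // as'; move: aK; rewrite {2}as' cK => /a0.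
by rewrite (IH (ctail s) (ctail s'))// => i it; exact: ss'.
Qed.

Lemma meet_take s t k : meet s (take k t) = minn k (meet s t).
Proof.
elim: t s k => [|[a b] t IH] s [|k]; rewrite ?minn0 ?min0n//=.
by rewrite IH; case: ifP => // _; rewrite ?minnSS ?minn0.
Qed.

Lemma meet_agree s s' k t : (forall i, (i < k)%N -> s i = s' i) -> (size t <= k)%N ->
  meet s t = meet s' t.
Proof.
elim: t s s' k => //= -[a b] t IH s s' [//|k] ss' tk.
by rewrite ss'// (IH (ctail s) (ctail s') k)// => i ik; exact: ss'.
Qed.

Lemma meet_branch s s' k v : (forall i, (i < k)%N -> s i = s' i) -> s k != s' k ->
  (forall i, s i != None) -> meet s (branch s' v) = minn k (size v).
Proof.
elim: v s s' k => [|b v IH] s s' k ss' sk s0 /=; first by rewrite minn0.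
case: k ss' sk => [|k] ss' sk.
  by rewrite [s' 0%N == s 0%N]eq_sym (negbTE sk) andbF min0n.
rewrite -(ss' 0%N)// s0 eqxx /= minnSS (IH (ctail s) (ctail s') k)// => [i ik|i].
  exact: ss'.
exact: s0.
Qed.

Lemma meet_branch_same s v : (forall i, s i != None) -> meet s (branch s v) = size v.
Proof.
elim: v s => //= b v IH s s0; rewrite s0 eqxx /= IH// => i.
exact: s0.
Qed.

Lemma meet_clip_le K n s t :
  (meet s [seq (clip K p.1, p.2) | p <- take n t] <= meet s t)%N.
Proof.
elim: t s n => [|[a b] t IH] s [|n] //=.
have [/andP[cN cE]|//] := ifP.
have ca : clip K a = a by move: cN; case: (a) => //= i; case: ifP.
by rewrite ca in cN cE *; rewrite cN cE /= ltnS.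
Qed.

Lemma meet_clip_ge K n s t L : (L <= n)%N ->
  (forall i, (i < L)%N -> clip K (s i) = s i) ->
  (minn L (meet s t) <= meet s [seq (clip K p.1, p.2) | p <- take n t])%N.
Proof.
elim: t s n L => [|[a b] t IH] s n [|L] Ln sL; rewrite ?minn0 ?min0n//.
case: n Ln => // n Ln /=; have [/andP[aN /eqP aE]|] := ifP; last by rewrite minn0.
rewrite aE sL// -aE aN eqxx /= minnSS ltnS; apply: IH => // i iL; exact: sL.
Qed.

(** Truncating a node can only shorten its agreement with a code, and does not
    shorten it below [L] if the first [L] letters of the code survive
    clipping. *)
Lemma meet_trunc K L s t : (L <= K)%N ->
  (forall i, (i < L)%N -> clip K (s i) = s i) ->
  (minn L (meet s t) <= meet s (trunc K t) <= meet s t)%N.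
Proof. by move=> LK sL; rewrite meet_clip_ge// meet_clip_le. Qed.

Lemma clip_bound s L : exists K, (L <= K)%N /\ forall i, (i < L)%N -> clip K (s i) = s i.
Proof.
pose m := (\max_(i < L) oapp S 0%N (s i))%N.
exists (maxn L m); split; first exact: leq_maxl.
move=> i iL; case E: (s i) => [a|//] /=.
have -> : (a < maxn L m)%N; last by [].
rewrite leq_max; apply/orP; right.
by have := @leq_bigmax _ (fun i : 'I_L => oapp S 0%N (s i)) (Ordinal iL); rewrite /= E.
Qed.

End Nodes.

Lemma trunc_finite K : exists l : seq node, forall t, trunc K t \in l.
Proof.
pose A : seq (letter * bool) :=
  allpairs pair (None :: map Some (iota 0 K)) [:: true; false].
have stepP n : exists l : seq node, forall t : node, (size t <= n)%N ->
    {subset t <= A} -> t \in l.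
  elim: n => [|n [l lP]]; first by exists [:: [::]] => -[].
  exists ([::] :: allpairs cons A l) => -[|p t] // tn tA.
  rewrite in_cons; apply/orP; right; apply: allpairs_f.
    by apply: tA; rewrite in_cons eqxx.
  by apply: lP => // q qt; apply: tA; rewrite in_cons qt orbT.
have [l lP] := stepP K; exists l => t; apply: lP.
  by rewrite size_map size_take_min geq_minl.
move=> _ /mapP[[a b] _ ->]; apply: allpairs_f; last by case: b.
case: a => //= i; case: ifP => // iK; rewrite in_cons; apply/orP; right.
by apply/mapP; exists i => //; rewrite mem_iota.
Qed.

(** * The space of tame functions *)

(** Equivalently, [x] extends to a continuous function on the inverse limit of
    the finite sets of truncated nodes. *)
Definition tame (R : realType) (x : node -> R) : Prop :=
  forall e, 0 < e -> exists K, forall t, `|x t - x (trunc K t)| <= e.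

Lemma tameW (R : realType) (x : node -> R) : tame x -> forall e, 0 < e ->
  exists K, forall L t, (K <= L)%N -> `|x t - x (trunc L t)| <= e.
Proof.
move=> tx e e0; have e2 : 0 < e / 2 by rewrite divr_gt0.
have [K xK] := tx _ e2; exists K => L t KL.
have h1 := xK t; have := xK (trunc L t).
rewrite trunc_trunc (minn_idPl KL) distrC => h2.
by rewrite (le_trans (ler_distD (x (trunc K t)) _ _))//; lra.
Qed.

(** A truncation takes finitely many values. *)
Lemma tame_bounded (R : realType) (x : node -> R) : tame x ->
  exists C, forall t, `|x t| <= C.
Proof.
move=> /(_ 1 ltr01)[K xK]; have [l lP] := trunc_finite K.
have [C lC] : exists C, forall t, t \in l -> `|x t| <= C.
  elim: l {lP} => [|s l [C IH]]; first by exists 0.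
  exists (Num.max `|x s| C) => t; rewrite in_cons => /orP[/eqP ->|/IH tC].
    by rewrite le_max lexx.
  by rewrite le_max tC orbT.
exists (C + 1) => t; have := lC _ (lP t); have := xK t.
have := ler_normD (x t - x (trunc K t)) (x (trunc K t)); rewrite subrK; lra.
Qed.

Definition tame_pred (R : realType) : {pred node -> R} := [pred x | `[< tame x >]].

Lemma tame_submod (R : realType) : submod_closed (@tame_pred R).
Proof.
split=> [|a x y]; rewrite !unfold_in /=.
  apply/asboolP => e e0; exists 0%N => t /=.
  by rewrite subrr normr0 ltW.
move=> /asboolP tx /asboolP ty; apply/asboolP => e e0.
have a0 : 0 < `|a| + 1 by rewrite ltr_wpDl.
have e1 : 0 < e / 2 / (`|a| + 1) by rewrite !divr_gt0.
have e2 : 0 < e / 2 by rewrite divr_gt0.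
have [K xK] := tameW tx e1; have [L yL] := tameW ty e2.
exists (maxn K L) => t.
have hx := xK _ t (leq_maxl K L); have hy := yL _ t (leq_maxr K L).
set T := trunc _ t in hx hy *.
have -> : (a *: x + y) t - (a *: x + y) T = a * (x t - x T) + (y t - y T).
  by rewrite -[LHS]/((a * x t + y t) - (a * x T + y T)); ring.
rewrite (le_trans (ler_normD _ _))// normrM.
have : `|a| * `|x t - x T| <= e / 2.
  move: hx; rewrite ler_pdivlMr// => hx; rewrite (le_trans _ hx)//.
  by rewrite mulrC ler_wpM2l// lerDl.
by lra.
Qed.

HB.instance Definition _ (R : realType) :=
  GRing.isSubmodClosed.Build R (node -> R) (@tame_pred R) (@tame_submod R).

Record tame_fun (R : realType) : Type :=
  TameFun { tame_val :> node -> R; evalP : tame_val \in @tame_pred R }.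

HB.instance Definition _ (R : realType) := [isSub of tame_fun R for @tame_val R].
HB.instance Definition _ (R : realType) := [Choice of tame_fun R by <:].
HB.instance Definition _ (R : realType) := [SubChoice_isSubLmodule of tame_fun R by <:].

Section TameFun.
Context {R : realType}.
Implicit Types (x y : tame_fun R) (t : node).

Lemma tame_eval x : tame x.
Proof. by have := evalP x; rewrite unfold_in /= => /asboolP. Qed.

Definition tame_of (x : node -> R) (tx : tame x) : tame_fun R :=
  TameFun (asboolT tx : x \in @tame_pred R).

Lemma mk_tameE (x : node -> R) (tx : tame x) : tame_of tx =1 x.
Proof. by []. Qed.

Lemma tame_ext x y : x =1 y -> x = y.
Proof. by move=> xy; apply: val_inj; apply/funext. Qed.

Lemma evalD x y t : tame_val (x + y) t = x t + y t.
Proof. by []. Qed.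
Lemma evalZ a x t : tame_val (a *: x) t = a * x t.
Proof. by []. Qed.
Lemma evalN x t : tame_val (- x) t = - x t.
Proof. by []. Qed.
Lemma eval0 t : (0 : tame_fun R) t = 0.
Proof. by []. Qed.

Definition supnorm x : R := supf (fun t => `|x t|).

Lemma eval_le x t : `|x t| <= supnorm x.
Proof. by have [C xC] := tame_bounded (tame_eval x); exact: (le_supf t xC). Qed.

Lemma supnorm_le x c : (forall t, `|x t| <= c) -> supnorm x <= c.
Proof. by move=> xc; apply: (supf_le [::]). Qed.

Lemma seminorm_form (l : tame_fun R -> R) : (forall x y, l (x + y) = l x + l y) ->
  (forall a x, l (a *: x) = a * l x) -> seminorm (fun x => `|l x|).
Proof.
by move=> lD lZ; split=> [x y|a x]; [rewrite lD ler_normD | rewrite lZ normrM].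
Qed.

Lemma seminorm_eval t : seminorm (fun x => `|x t|).
Proof. exact: seminorm_form. Qed.

Lemma seminorm_supnorm : seminorm supnorm.
Proof.
apply: (@seminorm_sup _ _ _ [::] (fun t x => `|x t|) supnorm) => *.
  exact: seminorm_eval.
exact: eval_le.
Qed.

Lemma supnorm_eq0 x : supnorm x = 0 -> x = 0.
Proof.
move=> x0; apply: tame_ext => t; apply/eqP.
by rewrite eval0 -normr_le0 -x0 eval_le.
Qed.

End TameFun.

(** * A strictly convex seminorm *)

Section Rounding.
Context {R : realType}.
Implicit Types (x y z : tame_fun R) (t : node).

Lemma hypot_add (a b c d : R) :
  Num.sqrt ((a + c) ^+ 2 + (b + d) ^+ 2) <=
  Num.sqrt (a ^+ 2 + b ^+ 2) + Num.sqrt (c ^+ 2 + d ^+ 2).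
Proof.
have ab : 0 <= a ^+ 2 + b ^+ 2 by rewrite addr_ge0 ?sqr_ge0.
have cd : 0 <= c ^+ 2 + d ^+ 2 by rewrite addr_ge0 ?sqr_ge0.
set p := Num.sqrt (a ^+ 2 + _); set q := Num.sqrt (c ^+ 2 + _).
have p0 : 0 <= p := sqrtr_ge0 _; have q0 : 0 <= q := sqrtr_ge0 _.
have pE : p ^+ 2 = a ^+ 2 + b ^+ 2 by rewrite sqr_sqrtr.
have qE : q ^+ 2 = c ^+ 2 + d ^+ 2 by rewrite sqr_sqrtr.
rewrite -[leRHS]ger0_norm ?addr_ge0// -sqrtr_sqr ler_sqrt ?sqr_ge0//.
have pq : a * c + b * d <= p * q.
  rewrite (le_trans (ler_norm _))// -ler_sqr ?nnegrE ?mulr_ge0//.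
  rewrite -normrX ger0_norm ?sqr_ge0// exprMn pE qE.
  have -> : (a ^+ 2 + b ^+ 2) * (c ^+ 2 + d ^+ 2) =
    (a * c + b * d) ^+ 2 + (a * d - b * c) ^+ 2 by ring.
  by rewrite lerDl sqr_ge0.
by rewrite [leRHS]sqrrD pE qE !sqrrD; lra.
Qed.

(** The equality case of the triangle inequality in the Euclidean plane. *)
Lemma hypot_add_eq (a b c d : R) :
  Num.sqrt (a ^+ 2 + b ^+ 2) + Num.sqrt (c ^+ 2 + d ^+ 2) <=
  Num.sqrt ((a + c) ^+ 2 + (b + d) ^+ 2) -> a * d = b * c.
Proof.
have ab : 0 <= a ^+ 2 + b ^+ 2 by rewrite addr_ge0 ?sqr_ge0.
have cd : 0 <= c ^+ 2 + d ^+ 2 by rewrite addr_ge0 ?sqr_ge0.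
have abcd : 0 <= (a + c) ^+ 2 + (b + d) ^+ 2 by rewrite addr_ge0 ?sqr_ge0.
set p := Num.sqrt (a ^+ 2 + _); set q := Num.sqrt (c ^+ 2 + _).
have p0 : 0 <= p := sqrtr_ge0 _; have q0 : 0 <= q := sqrtr_ge0 _.
have pE : p ^+ 2 = a ^+ 2 + b ^+ 2 by rewrite sqr_sqrtr.
have qE : q ^+ 2 = c ^+ 2 + d ^+ 2 by rewrite sqr_sqrtr.
move=> h; have pq : p * q <= a * c + b * d.
  have : (p + q) ^+ 2 <= (a + c) ^+ 2 + (b + d) ^+ 2.
    by rewrite -(sqr_sqrtr abcd) ler_sqr ?nnegrE ?addr_ge0 ?sqrtr_ge0.
  by rewrite sqrrD pE qE !sqrrD; lra.
have ac0 : 0 <= a * c + b * d by rewrite (le_trans _ pq)// mulr_ge0.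
have : (p * q) ^+ 2 <= (a * c + b * d) ^+ 2 by rewrite ler_sqr ?nnegrE// mulr_ge0.
have -> : (p * q) ^+ 2 = (a * c + b * d) ^+ 2 + (a * d - b * c) ^+ 2.
  by rewrite exprMn pE qE; ring.
rewrite gerDl => le0; have : (a * d - b * c) ^+ 2 == 0 by rewrite eq_le le0 sqr_ge0.
by rewrite sqrf_eq0 subr_eq0 => /eqP.
Qed.

Lemma sqrt_sqrD_seminorm (V : lmodType R) (p q : V -> R) :
  seminorm p -> seminorm q -> seminorm (fun x : V => Num.sqrt (p x ^+ 2 + q x ^+ 2)).
Proof.
move=> sp sq; split=> [x y|a x].
  rewrite (le_trans _ (hypot_add _ _ _ _))// ler_wsqrtr//.
  by rewrite lerD// ler_sqr ?nnegrE ?addr_ge0 ?seminorm_ge0// ?sp.1 ?sq.1.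
by rewrite sp.2 sq.2 !exprMn -mulrDr sqrtrM ?sqr_ge0// sqrtr_sqr normr_id.
Qed.

Definition node_of (i : nat) : node := odflt [::] (unpickle i).

(** Coupling each coordinate with the uniform norm lets the equality cases of
    the single coordinates combine: all of them have the same proportionality
    factor. *)
Definition pair_norm t x : R := Num.sqrt (supnorm x ^+ 2 + `|x t| ^+ 2).

(** The weights make the sum at most the uniform norm, since a [pair_norm] is
    at most twice that norm. *)
Definition round_sum n x : R := \sum_(i < n) 2^-1 ^+ i.+2 * pair_norm (node_of i) x.

Definition rounding x : R := supf (round_sum ^~ x).

Lemma seminorm_pair_norm t : seminorm (pair_norm t).
Proof. by apply: sqrt_sqrD_seminorm; [exact: seminorm_supnorm | exact: seminorm_eval]. Qed.

Lemma seminorm_sum (V : lmodType R) n (c : nat -> R) (p : nat -> V -> R) :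
  (forall i, 0 <= c i) -> (forall i, seminorm (p i)) ->
  seminorm (fun x : V => \sum_(i < n) c i * p i x).
Proof.
move=> c0 sp; elim: n => [|n IH].
  by split=> *; rewrite !big_ord0 ?addr0 ?mulr0.
split=> [x y|a x]; rewrite !big_ord_recr /=.
  have := IH.1 x y; have := ler_wpM2l (c0 n) ((sp n).1 x y).
  by rewrite mulrDr; lra.
by rewrite IH.2 (sp n).2 mulrDr; congr (_ + _); rewrite mulrCA.
Qed.

Lemma pow_half_ge0 i : 0 <= (2^-1 : R) ^+ i.
Proof. by rewrite exprn_ge0// invr_ge0. Qed.

Lemma seminorm_round_sum n : seminorm (round_sum n).
Proof.
apply: (@seminorm_sum _ n (fun i => 2^-1 ^+ i.+2) (fun i => pair_norm (node_of i))).
  by move=> i; exact: pow_half_ge0.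
by move=> i; exact: seminorm_pair_norm.
Qed.

Lemma pair_norm_le t x : pair_norm t x <= 2 * supnorm x.
Proof.
have s0 := seminorm_ge0 x seminorm_supnorm.
rewrite -[leRHS]ger0_norm ?mulr_ge0// -sqrtr_sqr ler_wsqrtr// exprMn.
have : `|x t| ^+ 2 <= supnorm x ^+ 2 by rewrite ler_sqr ?nnegrE// eval_le.
by have := sqr_ge0 (supnorm x); lra.
Qed.

Lemma round_sum_le n x : round_sum n x <= supnorm x.
Proof.
have s0 := seminorm_ge0 x seminorm_supnorm.
have h : \sum_(i < n) 2^-1 ^+ i.+2 * pair_norm (node_of i) x <= (1 - 2^-1 ^+ n) * supnorm x.
  elim: n => [|n IH]; first by rewrite big_ord0 expr0 subrr mul0r.
  rewrite big_ord_recr /= (le_trans (lerD IH (ler_wpM2l (pow_half_ge0 _) (pair_norm_le _ _))))//.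
  by rewrite !exprS; lra.
by rewrite (le_trans h)// ler_piMl// lerBlDr lerDl pow_half_ge0.
Qed.

Lemma round_le x : rounding x <= supnorm x.
Proof. by apply: (supf_le 0%N) => n; exact: round_sum_le. Qed.

Lemma le_round n x : round_sum n x <= rounding x.
Proof. by apply: (@le_supf _ _ (round_sum ^~ x) (supnorm x)) => m; exact: round_sum_le. Qed.

Lemma seminorm_round : seminorm rounding.
Proof.
apply: (@seminorm_sup _ _ _ 0%N _ supnorm); last by move=> *; exact: round_sum_le.
exact: seminorm_round_sum.
Qed.

(** Every summand is a seminorm, so the convexity defect of the sum dominates
    that of each summand. *)
Lemma round_gap t x z : exists2 c, 0 < c &
  c * (pair_norm t x + pair_norm t z - 2 * pair_norm t (2^-1 *: (x + z))) <=
  rounding x + rounding z - 2 * rounding (2^-1 *: (x + z)).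
Proof.
set m := 2^-1 *: _.
pose gap s := pair_norm s x + pair_norm s z - 2 * pair_norm s m.
have gap0 s : 0 <= gap s.
  by rewrite subr_ge0; exact: seminorm_mid (seminorm_pair_norm s).
exists (2^-1 ^+ (pickle t).+2); first by rewrite exprn_gt0// invr_gt0.
rewrite -/(gap t); set g := _ * gap t.
suff : rounding m <= (rounding x + rounding z - g) / 2 by lra.
apply: (supf_le 0%N) => n; rewrite ler_pdivlMr//.
have mono k l y : (k <= l)%N -> round_sum k y <= round_sum l y.
  move=> kl; rewrite /round_sum -!(big_mkord xpredT (fun i => 2^-1 ^+ i.+2 * pair_norm (node_of i) y)).
  rewrite [leRHS](big_cat_nat (n := k))//= lerDl; apply: sumr_ge0 => i _.
  by rewrite mulr_ge0 ?pow_half_ge0// sqrtr_ge0.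
set k := maxn n (pickle t).+1.
have : g <= round_sum k x + round_sum k z - 2 * round_sum k m.
  have tk : (pickle t < k)%N by rewrite leq_max leqnn orbT.
  rewrite /round_sum mulr_sumr -!big_split /= -sumrB (bigD1 (Ordinal tk)) //=.
  rewrite /node_of pickleK /= -[leLHS]addr0 lerD//.
    by rewrite /g /gap le_eqVlt; apply/orP; left; apply/eqP; ring.
  apply: sumr_ge0 => i _.
  rewrite (_ : _ - _ = 2^-1 ^+ i.+2 * gap (node_of i)).
    by rewrite mulr_ge0 ?pow_half_ge0.
  by rewrite /gap /node_of; ring.
have := mono _ _ m (leq_maxl n (pickle t).+1); rewrite -/k.
by have := le_round k x; have := le_round k z; lra.
Qed.

Lemma round_strict x z : rounding x + rounding z <= 2 * rounding (2^-1 *: (x + z)) ->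
  supnorm x *: z = supnorm z *: x.
Proof.
move=> h; apply: tame_ext => t; rewrite !evalZ.
have [c c0 gap] := round_gap t x z.
have : pair_norm t x + pair_norm t z <= 2 * pair_norm t (2^-1 *: (x + z)).
  rewrite -subr_le0 -(pmulr_rle0 _ c0) (le_trans gap)//.
  by rewrite subr_le0.
rewrite (seminorm_pair_norm t).2 ger0_norm ?invr_ge0// mulrA.
rewrite (_ : 2 * 2^-1 = 1) ?mul1r; last by field.
rewrite /pair_norm !real_normK ?num_real// => le.
rewrite [RHS]mulrC; apply: hypot_add_eq; apply: (le_trans le); apply: ler_wsqrtr.
rewrite lerD2r ler_sqr ?nnegrE ?addr_ge0 ?seminorm_ge0 ?seminorm_supnorm.1//.
all: exact: seminorm_supnorm.
Qed.
End Rounding.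

(** * Clauses and the norm *)

(** One injection into the natural numbers distributes the steps and the
    bounds of all certificates over the positions of a code. *)
Definition step_pos (n : nat) : nat :=
  pickle (inl n : nat + (seq bool * seq bool * nat)).
Definition bound_pos (v u : seq bool) (n : nat) : nat :=
  pickle (inr (v, u, n) : nat + (seq bool * seq bool * nat)).

(** [Cert v u n b] asks that the functional of address [v], perturbed by a
    multiple of the one of address [u], be bounded as recorded in the code;
    [b] is the sign of the perturbation. [Stem t] asks that the value at [t]
    be that of the last node before [t] leaves the branch. *)
Variant clause := Trivial | Cert of seq bool & seq bool & nat & bool | Stem of node.

Definition cert_data (s : code) v u n : option (nat * nat) :=
  if s (step_pos n) is Some a then
    if s (bound_pos v u n) is Some d then Some (a, d) else None
  else None.

(** Codes that agree on this many letters agree about the clause. Counting the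
    letters of a stem as well makes this true of nearby codes. *)
Definition clause_depth (c : clause) : nat :=
  match c with
  | Trivial => 0
  | Cert v u n _ =>
      maxn (maxn (step_pos n) (bound_pos v u n)).+1 (maxn (size v) (size u))
  | Stem t => maxn (size t) (\max_(p <- t) oapp S 0 p.1)
  end%N.

Section Norm.
Context {R : realType}.
Implicit Types (x y z : tame_fun R) (t : node) (s : code) (c : clause).

(** The bounds for the two signs add up to [2 + 2 * e]; a single number [d]
    encodes both. The truncation at [3] keeps them in the range where the
    penalized expressions are seminorms. *)
Definition cert_bound (a d n : nat) (b : bool) : R :=
  let e := damp R a * damp R n in
  let m := Num.min (d%:R * e) 3 in
  if b then 2 + 2 * e - m else m.

(** A certificate whose data contain the letter at infinity gets a bound so
    negative that only functions vanishing on the branch satisfy it, and that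
    its penalty is at least that of any finite data; this is what upper
    semicontinuity at infinity needs. *)
Definition clause_bound s c : R :=
  match c with
  | Cert v u n b =>
      if cert_data s v u n is Some (a, d) then cert_bound a d n b else -4
  | _ => 0
  end.

Definition clause_form s c x : R :=
  match c with
  | Trivial => 0
  | Cert v u n b =>
      if cert_data s v u n is Some (a, _) then
        x (branch s v) + (-1) ^+ b * damp R a * x (branch s u)
      else 0
  | Stem t => x t - x (take (meet s t) t)
  end.

Definition clause_weight c : R := 16^-1 * damp R (clause_depth c).

Definition branch_norm s x : R := supf (fun v => `|x (branch s v)|).

(** The penalty is the positive part of this quantity, thanks to [Trivial],
    whose excess is zero. *)
Definition clause_excess s x c : R := `|clause_form s c x| - clause_bound s c * branch_norm s x.

Definition clause_term r s x c : R :=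
  (1 - r ^+ 2) * branch_norm s x + (1 + r) * (clause_weight c * clause_excess s x c).

Definition penalized r s x : R := supf (clause_term r s x).

Definition step_size (a : letter) : R := if a is Some i then damp R i.+1 else 0.

(** The first letter of a code chooses the parameter [r], and infinity
    corresponds to [r = 0]. *)
Definition code_norm (k : code) x : R :=
  penalized (step_size (k 0%N)) (ctail k) x + step_size (k 0%N) ^+ 2 * rounding x.

Definition full_norm x : R := supf (code_norm ^~ x).

Lemma weight_gt0 c : 0 < clause_weight c.
Proof. by rewrite mulr_gt0 ?damp_gt0// invr_gt0. Qed.

Lemma weight_le c : clause_weight c <= 16^-1.
Proof. by rewrite ler_piMr ?damp_le1// invr_ge0. Qed.

Lemma bound_itv s c : -4 <= clause_bound s c <= 4.
Proof.
case: c => [|v u n b|t] /=; try by apply/andP; split; lra.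
case: cert_data => [[a d]|]; last by apply/andP; split; lra.
rewrite /cert_bound; set e := damp R a * _.
have e0 : 0 <= e by rewrite mulr_ge0 ?(ltW (damp_gt0 _ _)).
have e1 : e <= 1 by rewrite mulr_ile1 ?damp_le1 ?(ltW (damp_gt0 _ _)).
have m3 : Num.min (d%:R * e) 3 <= 3 by rewrite ge_min lexx orbT.
have m0 : 0 <= Num.min (d%:R * e) 3 by rewrite le_min mulr_ge0//=.
by case: b; apply/andP; split; lra.
Qed.

Lemma cert_bound_ge a d n b : -1 <= cert_bound a d n b.
Proof.
rewrite /cert_bound; set e := damp R a * _.
have e0 : 0 <= e by rewrite mulr_ge0 ?(ltW (damp_gt0 _ _)).
have m3 : Num.min (d%:R * e) 3 <= 3 by rewrite ge_min lexx orbT.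
have m0 : 0 <= Num.min (d%:R * e) 3 by rewrite le_min mulr_ge0//=.
by case: b; lra.
Qed.

Lemma step_ge0 a : 0 <= step_size a.
Proof. by case: a => [i|] //=; rewrite ltW// damp_gt0. Qed.

Lemma step_le a : step_size a <= 2^-1.
Proof. by case: a => [i|] /=; [exact: (@damp_le R 1) | rewrite invr_ge0]. Qed.

Lemma le_branch_norm s v x : `|x (branch s v)| <= branch_norm s x.
Proof.
apply: (@le_supf _ _ (fun v => `|x (branch s v)|) (supnorm x)) => j.
exact: eval_le.
Qed.

Lemma branch_norm_le s x : branch_norm s x <= supnorm x.
Proof. by apply: (supf_le [::]) => v; exact: eval_le. Qed.

Lemma seminorm_branch_norm s : seminorm (branch_norm s).
Proof.
apply: (@seminorm_sup _ _ _ [::] (fun v x => `|x (branch s v)|) supnorm) => *.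
  exact: seminorm_eval.
exact: eval_le.
Qed.

Lemma branch_norm_ge0 s x : 0 <= branch_norm s x.
Proof. exact: seminorm_ge0 (seminorm_branch_norm s). Qed.

Lemma supnorm_ge0 x : 0 <= supnorm x.
Proof. exact: seminorm_ge0 seminorm_supnorm. Qed.

Lemma formD s c x y : clause_form s c (x + y) = clause_form s c x + clause_form s c y.
Proof.
case: c => [|v u n b|t]; rewrite /clause_form ?addr0//.
  by case: cert_data => [[a d]|]; rewrite ?addr0// !evalD; ring.
by rewrite !evalD; ring.
Qed.

Lemma formZ s c a x : clause_form s c (a *: x) = a * clause_form s c x.
Proof.
case: c => [|v u n b|t]; rewrite /clause_form ?mulr0//.
  by case: cert_data => [[a' d]|]; rewrite ?mulr0// !evalZ; ring.
by rewrite !evalZ; ring.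
Qed.

Lemma form_le s c x : `|clause_form s c x| <= 2 * supnorm x.
Proof.
have s0 := supnorm_ge0 x.
case: c => [|v u n b|t] /=; first by rewrite normr0 mulr_ge0.
  case: cert_data => [[a d]|]; last by rewrite normr0 mulr_ge0.
  rewrite (le_trans (ler_normD _ _))// !normrM normrX normrN1 expr1n mul1r.
  rewrite (ger0_norm (ltW (damp_gt0 R a))).
  have := ler_pM (ltW (damp_gt0 R a)) (normr_ge0 _) (damp_le1 R a) (eval_le x (branch s u)).
  by have := eval_le x (branch s v); lra.
rewrite (le_trans (ler_normB _ _))//.
by have := eval_le x t; have := eval_le x (take (meet s t) t); lra.
Qed.

Lemma cert_form_le s v u n b x :
  `|clause_form s (Cert v u n b) x| <= 2 * branch_norm s x.
Proof.
rewrite /=; case: cert_data => [[a d]|]; last by rewrite normr0 mulr_ge0// branch_norm_ge0.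
rewrite (le_trans (ler_normD _ _))// !normrM normrX normrN1 expr1n mul1r.
rewrite (ger0_norm (ltW (damp_gt0 R a))).
have := ler_pM (ltW (damp_gt0 R a)) (normr_ge0 _) (damp_le1 R a) (le_branch_norm s u x).
by have := le_branch_norm s v x; lra.
Qed.

Lemma excess_le s x c : clause_excess s x c <= 6 * supnorm x.
Proof.
rewrite /clause_excess; have /andP[b1 _] := bound_itv s c.
have := form_le s c x; have := branch_norm_le s x.
have : - clause_bound s c * branch_norm s x <= 4 * branch_norm s x.
  by rewrite ler_wpM2r ?branch_norm_ge0//; lra.
by rewrite mulNr; lra.
Qed.

Lemma weight_excess_le s x c e : clause_excess s x c <= e -> 0 <= e ->
  clause_weight c * clause_excess s x c <= 16^-1 * e.
Proof.
move=> ee e0; rewrite (le_trans (ler_wpM2l (ltW (weight_gt0 c)) ee))//.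
by rewrite ler_wpM2r// weight_le.
Qed.

Section StepParameter.
Variable r : R.
Hypothesis r_itv : 0 <= r <= 2^-1.

(** In this form the coefficients are nonnegative, which makes the expression
    a seminorm. *)
Lemma term_seminormE s x c : clause_term r s x c =
  (1 - r ^+ 2 - (1 + r) * clause_weight c * clause_bound s c) * branch_norm s x +
  (1 + r) * clause_weight c * `|clause_form s c x|.
Proof. by rewrite /clause_term /clause_excess; ring. Qed.

Lemma term_coef_ge0 s c : 0 <= 1 - r ^+ 2 - (1 + r) * clause_weight c * clause_bound s c.
Proof.
have /andP[r0 r2] := r_itv; have /andP[b1 b2] := bound_itv s c.
have w0 := weight_gt0 c; have w1 := weight_le c.
have rr : r ^+ 2 <= 4^-1.
  by rewrite expr2 (le_trans (ler_pM r0 r0 r2 r2))//; lra.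
have wb : clause_weight c * clause_bound s c <= 16^-1 * 4.
  rewrite (le_trans (ler_wpM2l (ltW w0) b2))//.
  by rewrite ler_wpM2r.
have : (1 + r) * (clause_weight c * clause_bound s c) <= (1 + r) * (16^-1 * 4).
  by rewrite ler_wpM2l//; lra.
by rewrite mulrA; lra.
Qed.

Lemma seminorm_term s c : seminorm (fun x => clause_term r s x c).
Proof.
have /andP[r0 r2] := r_itv.
have -> : (fun x => clause_term r s x c) = fun x =>
    (1 - r ^+ 2 - (1 + r) * clause_weight c * clause_bound s c) * branch_norm s x +
    (1 + r) * clause_weight c * `|clause_form s c x|.
  by apply/funext => x; exact: term_seminormE.
apply: seminormD; apply: seminormM.
- exact: term_coef_ge0.
- exact: seminorm_branch_norm.
- by rewrite mulr_ge0 ?(ltW (weight_gt0 c))// addr_ge0.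
- by apply: seminorm_form; [exact: formD | exact: formZ].
Qed.

Lemma term_le s x c : clause_term r s x c <= branch_norm s x + 9 / 16 * supnorm x.
Proof.
have /andP[r0 r2] := r_itv; have s0 := supnorm_ge0 x.
have wE : clause_weight c * clause_excess s x c <= 16^-1 * (6 * supnorm x).
  by apply: weight_excess_le; [exact: excess_le | rewrite mulr_ge0].
rewrite /clause_term; have : (1 - r ^+ 2) * branch_norm s x <= branch_norm s x.
  by rewrite ler_piMl ?branch_norm_ge0// lerBlDr lerDl sqr_ge0.
have : (1 + r) * (clause_weight c * clause_excess s x c) <= (1 + r) * (16^-1 * (6 * supnorm x)).
  by rewrite ler_wpM2l// addr_ge0.
have : (1 + r) * (16^-1 * (6 * supnorm x)) <= (3 / 2) * (16^-1 * (6 * supnorm x)).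
  by rewrite ler_wpM2r ?mulr_ge0// ?invr_ge0//; lra.
by lra.
Qed.

Lemma le_penalized s x c : clause_term r s x c <= penalized r s x.
Proof. exact: (le_supf _ (term_le s x)). Qed.

Lemma penalized_ge_branch s x : (1 - r ^+ 2) * branch_norm s x <= penalized r s x.
Proof.
rewrite (le_trans _ (le_penalized s x Trivial))// /clause_term /clause_excess /=.
by rewrite normr0 mul0r subr0 !mulr0 addr0.
Qed.

Lemma penalized_le s x : penalized r s x <= branch_norm s x + 9 / 16 * supnorm x.
Proof. by apply: (supf_le Trivial) => c; exact: term_le. Qed.

Lemma seminorm_penalized s : seminorm (penalized r s).
Proof.
apply: (@seminorm_sup _ _ _ Trivial (fun c x => clause_term r s x c)
  (fun x => branch_norm s x + 9 / 16 * supnorm x)).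
- by move=> c; exact: seminorm_term.
- by move=> c x; exact: term_le.
Qed.

End StepParameter.

Lemma step_itv a : 0 <= step_size a <= 2^-1.
Proof. by rewrite step_ge0 step_le. Qed.

Lemma code_norm_le k x : code_norm k x <= 2 * supnorm x.
Proof.
rewrite /code_norm; have := penalized_le (step_itv (k 0%N)) (ctail k) x.
have := branch_norm_le (ctail k) x; have s0 := supnorm_ge0 x.
have : step_size (k 0%N) ^+ 2 * rounding x <= 4^-1 * supnorm x.
  rewrite ler_pM ?sqr_ge0 ?round_le// ?(seminorm_ge0 _ seminorm_round)//.
  have := step_ge0 (k 0%N); have := step_le (k 0%N).
  move=> r2 r0; rewrite expr2 (le_trans (ler_pM r0 r0 r2 r2))//; lra.
by lra.
Qed.

Lemma seminorm_code_norm k : seminorm (code_norm k).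
Proof.
apply: seminormD; first exact: seminorm_penalized (step_itv _) _.
by apply: seminormM; [exact: sqr_ge0 | exact: seminorm_round].
Qed.

Lemma le_full_norm k x : code_norm k x <= full_norm x.
Proof.
exact: (@le_supf _ _ (code_norm ^~ x) (2 * supnorm x) k (code_norm_le ^~ x)).
Qed.

Lemma full_norm_le x : full_norm x <= 2 * supnorm x.
Proof. by apply: (supf_le (fun _ => None)) => k; exact: code_norm_le. Qed.

Lemma seminorm_full_norm : seminorm full_norm.
Proof.
apply: (@seminorm_sup _ _ _ (fun _ => None) code_norm (fun x => 2 * supnorm x)).
  exact: seminorm_code_norm.
exact: code_norm_le.
Qed.

Lemma node_on_branch t : exists2 k : code, k 0%N = None & branch (ctail k) (unzip2 t) = t.
Proof.
exists (fun i => if i is j.+1 then (nth (None, true) t j).1 else None) => //.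
elim: t => //= -[a b] t IH /=; congr cons; rewrite -[RHS]IH.
by apply: eq_branch.
Qed.

(** Each node lies on the branch of some code with [r = 0]. *)
Lemma supnorm_le_full x : supnorm x <= full_norm x.
Proof.
apply: supnorm_le => t; have [k k0 kt] := node_on_branch t.
rewrite (le_trans _ (le_full_norm k x))// /code_norm k0 /= expr0n /= mul0r addr0.
rewrite -{1}kt (le_trans (le_branch_norm _ _ _))//.
have := penalized_ge_branch (step_itv None) (ctail k) x.
by rewrite /= expr0n /= subr0 mul1r.
Qed.

End Norm.

(** * The supremum over codes is attained *)

Section UpperSemicontinuity.
Context {R : realType}.

(** The neighbourhoods are uniform in [k]; this is more than semicontinuity,
    but it holds for the norm and replaces covering arguments. *)
Definition usc (F : code -> R) : Prop :=
  forall e, 0 < e -> exists K, forall k k', near_code K k k' -> F k' <= F k + e.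

Definition has_prefix (s : seq letter) (k : code) : Prop :=
  forall i, (i < size s)%N -> k i = nth None s i.

Lemma extends_rcons s a k : has_prefix s k -> k (size s) = a -> has_prefix (rcons s a) k.
Proof.
move=> sk ka i; rewrite size_rcons ltnS nth_rcons leq_eqVlt => /predU1P[->|is_].
  by rewrite ltnn eqxx.
by rewrite is_ sk.
Qed.

(** The letters of a maximizer are chosen one after the other, keeping the
    supremum over all extensions unchanged: if every next letter lowered it,
    so would infinity, hence by semicontinuity also all large letters by a
    common amount, and the remaining letters are finitely many. *)
Lemma usc_max (F : code -> R) C : usc F -> (forall k, F k <= C) ->
  exists k, forall k', F k' <= F k.
Proof.
move=> uF FC; pose M := supf F.
have FM k : F k <= M by exact: (le_supf k FC).
pose big s := forall e, 0 < e -> exists2 k, has_prefix s k & M - e < F k.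
have big0 : big [::].
  move=> e e0; have [|k Mk] := @supf_gt R _ (fun _ => None) F (M - e).
    by rewrite gtrBl.
  by exists k.
have bigS s : big s -> exists a, big (rcons s a).
  move=> bs; apply: contrapT => /forallNP nb.
  have bad a : exists2 e, 0 < e & forall k, has_prefix (rcons s a) k -> F k <= M - e.
    have /existsNP[e /not_implyP[e0 ne]] := nb a; exists e => // k sk.
    by rewrite leNgt; apply/negP => Fk; apply: ne; exists k.
  have [e0 e00 b0] := bad None.
  have [K KF] := uF _ (divr_gt0 e00 (ltr0Sn _ 1)).
  pose L := maxn K (size s).+1.
  have [e1 e10 b1] : exists2 e, 0 < e & forall i k, (i < L)%N ->
      has_prefix (rcons s (Some i)) k -> F k <= M - e.
    elim: L => [|L [e ep eb]]; first by exists 1.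
    have [e' e'p e'b] := bad (Some L).
    exists (Num.min e e'); first by rewrite lt_min ep e'p.
    move=> i k; rewrite ltnS leq_eqVlt => /predU1P[->|iL] sk.
      by rewrite (le_trans (e'b _ sk))// lerB// ge_min lexx orbT.
    by rewrite (le_trans (eb _ _ iL sk))// lerB// ge_min lexx.
  have [|k sk] := bs (Num.min (e0 / 2) e1).
    by rewrite lt_min e10 divr_gt0.
  apply/negP; rewrite -leNgt.
  case E : (k (size s)) => [i|]; last first.
    rewrite (le_trans (b0 _ (extends_rcons sk E)))// lerB// ge_min.
    by apply/orP; left; lra.
  have [iL|Li] := ltnP i L.
    rewrite (le_trans (b1 _ _ iL (extends_rcons sk E)))// lerB// ge_min.
    by rewrite lexx orbT.
  (* a large letter is close to infinity *)
  pose k' : code := fun j => if j == size s then None else k j.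
  have sk' : has_prefix (rcons s None) k'.
    apply: extends_rcons; last by rewrite /k' eqxx.
    by move=> j js; rewrite /k' ltn_eqF// sk.
  have kk' : near_code K k' k.
    move=> j jK; rewrite /k'; case: eqVneq => [->|]; last by left.
    right; rewrite E /= ltnNge (leq_trans _ Li)//; exact: leq_maxl.
  have := KF _ _ kk'; have := b0 _ sk' => h1 h2.
  rewrite (le_trans (_ : _ <= M - e0 / 2))//; first by lra.
  by rewrite lerB// ge_min lexx.
have [f fP] : exists f : seq letter -> letter, forall s, big s -> big (rcons s (f s)).
  have /choice[f fP] : forall s, exists a, big s -> big (rcons s a).
    move=> s; have [/bigS[a ba]|nb] := pselect (big s); first by exists a.
    by exists None.
  by exists f.
pose S n := iter n (fun s => rcons s (f s)) [::].
pose k : code := fun i => f (S i).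
have Ssize n : size (S n) = n by elim: n => //= n IH; rewrite size_rcons IH.
have Snth n i : (i < n)%N -> nth None (S n) i = k i.
  elim: n => //= n IH; rewrite nth_rcons Ssize ltnS leq_eqVlt => /predU1P[->|iS].
    by rewrite ltnn eqxx.
  by rewrite iS IH.
have Sbig n : big (S n) by elim: n => //= n IH; exact: fP.
exists k => k'; apply: (le_trans (FM k')); apply/ler_addgt0Pr => e e0.
have e2 : 0 < e / 2 by rewrite divr_gt0.
have [K KF] := uF _ e2; have [k1 Sk1 Mk1] := Sbig K _ e2.
have kk1 : near_code K k k1.
  by move=> i iK; left; rewrite Sk1 ?Ssize// Snth.
by have := KF _ _ kk1; lra.
Qed.

End UpperSemicontinuity.

Section CodeNormUsc.
Context {R : realType}.
Implicit Types (x : tame_fun R) (s : code) (c : clause).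

Lemma nearby_sym_branch x (e : R) K s s' v :
  (forall t, `|x t - x (trunc K t)| <= e) -> near_code K s s' ->
  `|x (branch s v) - x (branch s' v)| <= 2 * e.
Proof.
move=> xK ss'; have h1 := xK (branch s v); have := xK (branch s' v).
rewrite (trunc_branch_nearby v ss') distrC => h2.
by rewrite (le_trans (ler_distD (x (trunc K (branch s v))) _ _))//; lra.
Qed.

Lemma branch_norm_nearby x (e : R) K s s' :
  (forall t, `|x t - x (trunc K t)| <= e) -> near_code K s s' ->
  `|branch_norm s x - branch_norm s' x| <= 2 * e.
Proof.
move=> xK ss'; have d v := nearby_sym_branch v xK ss'.
rewrite ler_norml; apply/andP; split.
  suff : branch_norm s' x <= branch_norm s x + 2 * e by lra.
  apply: (supf_le [::]) => v; have := le_branch_norm s v x; have := d v.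
  have := ler_normD (x (branch s' v) - x (branch s v)) (x (branch s v)).
  by rewrite subrK distrC; lra.
suff : branch_norm s x <= branch_norm s' x + 2 * e by lra.
apply: (supf_le [::]) => v; have := le_branch_norm s' v x; have := d v.
have := ler_normD (x (branch s v) - x (branch s' v)) (x (branch s' v)).
by rewrite subrK; lra.
Qed.

Lemma cert_data_nearby K s s' v u n p : near_code K s s' ->
  (maxn (step_pos n) (bound_pos v u n) < K)%N -> cert_data s v u n = Some p ->
  cert_data s' v u n = Some p.
Proof.
move=> ss'; rewrite gtn_max => /andP[pK qK]; rewrite /cert_data.
case: (ss' _ pK) => [->|[-> _]]//; case: (s _) => // a.
by case: (ss' _ qK) => [->|[-> _]].
Qed.

Lemma stem_nearby K s s' t : near_code K s s' -> (clause_depth (Stem t) <= K)%N ->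
  meet s' t = meet s t.
Proof.
move=> ss'; rewrite /= geq_max => /andP[tK lK]; apply: (meet_nearby tK ss').
apply/allP => -[a b] pt /=; case: a pt => //= i it.
rewrite [(i < K)%N](_ : _ = true)//; apply: leq_trans lK.
by rewrite (big_rem (Some i, b))//= leq_maxl.
Qed.

(** The critical case is a certificate whose data contain infinity in [s] but
    not in the nearby [s']: the form in [s'] is at most twice the branch norm
    and the bound there is at least [-1], while the bound in [s] is [-4]. *)
Lemma excess_nearby x (e : R) K s s' c :
  (forall t, `|x t - x (trunc K t)| <= e) -> near_code K s s' -> (clause_depth c <= K)%N ->
  clause_excess s' x c <= clause_excess s x c + 12 * e.
Proof.
move=> xK ss' cK; have := branch_norm_nearby xK ss'.
have e0 : 0 <= e by rewrite (le_trans _ (xK [::])).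
set l := branch_norm s x; set l' := branch_norm s' x; rewrite ler_norml => /andP[l1 l2].
have l0 : 0 <= l := branch_norm_ge0 _ _; have l'0 : 0 <= l' := branch_norm_ge0 _ _.
have bl b : -4 <= b <= 4 -> - (b * l') <= - (b * l) + 8 * e.
  move=> /andP[b1 b2]; suff : b * (l - l') <= 8 * e by lra.
  rewrite (le_trans (ler_norm _))// normrM.
  have : `|b| * `|l - l'| <= 4 * (2 * e).
    by apply: ler_pM => //; rewrite ler_norml; apply/andP; split; lra.
  by lra.
case: c cK => [|v u n b|t] cK.
- by rewrite /clause_excess /= normr0 !mul0r; lra.
- have cK' : (maxn (step_pos n) (bound_pos v u n) < K)%N.
    by move: cK; rewrite /= geq_max => /andP[].
  rewrite /clause_excess -/l -/l'.
  case E : (cert_data s v u n) => [[a d]|].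
    have := bl _ (bound_itv s (Cert v u n b)).
    rewrite /= E (cert_data_nearby ss' cK' E).
    have := nearby_sym_branch v xK ss'; have := nearby_sym_branch u xK ss'.
    set xu := x (branch s u); set xu' := x (branch s' u).
    set xv := x (branch s v); set xv' := x (branch s' v) => du dv.
    have da := damp_le1 R a; have da0 := ltW (damp_gt0 R a).
    have : `|xv' + (-1) ^+ b * damp R a * xu'| <=
        `|xv + (-1) ^+ b * damp R a * xu| + 4 * e.
      have -> : xv' + (-1) ^+ b * damp R a * xu' =
        (xv + (-1) ^+ b * damp R a * xu) +
        ((xv' - xv) + (-1) ^+ b * damp R a * (xu' - xu)) by ring.
      rewrite (le_trans (ler_normD _ _))// lerD2l (le_trans (ler_normD _ _))//.
      rewrite !normrM normrX normrN1 expr1n mul1r (ger0_norm da0) distrC.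
      rewrite [`|xu' - xu|]distrC; have := ler_pM da0 (normr_ge0 (xu - xu')) da du.
      by lra.
    by lra.
  have := cert_form_le s' v u n b x; rewrite -/l'.
  rewrite /clause_bound E [clause_form s _ _]/= E normr0.
  case E' : (cert_data s' v u n) => [[a d]|].
    have : - (cert_bound a d n b * l') <= l'.
      by rewrite -mulNr ler_piMl// lerNl cert_bound_ge.
    by lra.
  by rewrite [clause_form s' _ _]/= E' normr0; lra.
- by rewrite /clause_excess /= (stem_nearby ss' cK) !mul0r; lra.
Qed.

(** Clauses deeper than [K] have weight at most a multiple of [damp R K]; the
    others behave alike in both codes. *)
Lemma penalized_nearby x (e r : R) K s s' : 0 <= r <= 2^-1 ->
  (forall t, `|x t - x (trunc K t)| <= e) -> near_code K s s' ->
  penalized r s' x <= penalized r s x + 4 * e + damp R K * supnorm x.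
Proof.
move=> r_itv xK ss'; have /andP[r0 r2] := r_itv.
have e0 : 0 <= e by rewrite (le_trans _ (xK [::])).
have S0 := supnorm_ge0 x; have dK := ltW (damp_gt0 R K).
have := branch_norm_nearby xK ss'; rewrite ler_norml => /andP[l1 l2].
have rr : 0 <= 1 - r ^+ 2 <= 1.
  rewrite lerBlDr lerDl sqr_ge0 andbT subr_ge0 expr2.
  by rewrite mulr_ile1//; lra.
have /andP[rr0 rr1] := rr.
have hl : (1 - r ^+ 2) * branch_norm s' x <= (1 - r ^+ 2) * branch_norm s x + 2 * e.
  have : (1 - r ^+ 2) * branch_norm s' x <= (1 - r ^+ 2) * (branch_norm s x + 2 * e).
    by rewrite ler_wpM2l//; lra.
  have : (1 - r ^+ 2) * (2 * e) <= 2 * e by rewrite ler_piMl// mulr_ge0.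
  by lra.
apply: (supf_le Trivial) => c; rewrite /clause_term.
have w0 := ltW (weight_gt0 (R := R) c); have w1 := weight_le (R := R) c.
have dS : 0 <= damp R K * supnorm x by rewrite mulr_ge0.
have [cK|Kc] := leqP (clause_depth c) K.
  have := ler_wpM2l w0 (excess_nearby xK ss' cK).
  have : clause_weight c * (12 * e) <= 16^-1 * (12 * e) by rewrite ler_wpM2r// mulr_ge0.
  move=> h1 h2.
  have h3 : clause_weight c * clause_excess s' x c <= clause_weight c * clause_excess s x c + 16^-1 * (12 * e) by lra.
  have := ler_wpM2l (addr_ge0 ler01 r0) h3.
  have : (1 + r) * (16^-1 * (12 * e)) <= (3 / 2) * (16^-1 * (12 * e)).
    by rewrite ler_wpM2r ?mulr_ge0 ?invr_ge0//; lra.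
  have := le_penalized r_itv s x c; rewrite /clause_term; lra.
have wq : clause_weight c * clause_excess s' x c <= 16^-1 * (6 * (damp R K * supnorm x)).
  rewrite (le_trans (ler_wpM2l w0 (excess_le s' x c)))//.
  have : damp R (clause_depth c) * supnorm x <= damp R K * supnorm x.
    by rewrite ler_wpM2r// damp_le// ltnW.
  by rewrite /clause_weight; lra.
have := ler_wpM2l (addr_ge0 ler01 r0) wq.
have : (1 + r) * (16^-1 * (6 * (damp R K * supnorm x))) <=
    (3 / 2) * (16^-1 * (6 * (damp R K * supnorm x))).
  by rewrite ler_wpM2r ?mulr_ge0 ?invr_ge0//; lra.
by have := penalized_ge_branch r_itv s x; lra.
Qed.

Lemma penalized_step_le x (r : R) s : 0 <= r <= 2^-1 ->
  penalized r s x <= penalized 0 s x + r * supnorm x.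
Proof.
move=> /andP[r0 r2]; have S0 := supnorm_ge0 x.
apply: (supf_le Trivial) => c.
have i0 := @step_itv R None.
have := le_penalized i0 s x c; rewrite /clause_term expr0n /= subr0 addr0 !mul1r.
have : clause_weight c * clause_excess s x c <= 16^-1 * (6 * supnorm x).
  by apply: weight_excess_le; [exact: excess_le | rewrite mulr_ge0].
move=> /(ler_wpM2l r0); have := mulr_ge0 r0 S0.
have := mulr_ge0 (sqr_ge0 r) (branch_norm_ge0 s x).
by lra.
Qed.

Lemma code_norm_usc x : usc (code_norm ^~ x).
Proof.
move=> e e0; have S0 := supnorm_ge0 x.
have e8 : 0 < e / 8 by rewrite divr_gt0.
have [K0 xK0] := tameW (tame_eval x) e8.
have S1 : 0 < supnorm x + 1 by rewrite ltr_wpDl.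
have [|K1 K1e] := @damp_small R (e / 6 / (supnorm x + 1)).
  by rewrite !divr_gt0.
pose K := maxn K0 K1; exists K.+1 => k k' kk'.
have xK t : `|x t - x (trunc K t)| <= e / 8 by apply: xK0; exact: leq_maxl.
have dK : damp R K * supnorm x <= e / 6.
  have : damp R K <= e / 6 / (supnorm x + 1).
    by rewrite (le_trans _ K1e)// damp_le// leq_maxr.
  rewrite ler_pdivlMr// => h; rewrite (le_trans _ h)// ler_wpM2l// ?(ltW (damp_gt0 _ _))//.
  by rewrite lerDl.
have tk : near_code K (ctail k) (ctail k').
  move=> i iK; have := kk' i.+1 iK; rewrite /near_letter /ctail.
  case=> [->|[-> cl]]; [by left | right; split=> //].
  by move: cl; case: (k' _) => //= j; case: (ltnP j K) => // jK; rewrite ltnS ltnW.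
rewrite /code_norm.
have := kk' 0%N isT; case=> [k0|[k0 cl]].
  have := penalized_nearby (step_itv (k 0%N)) xK tk; rewrite k0.
  by lra.
have i0 := @step_itv R None.
have := penalized_nearby i0 xK tk; rewrite k0 /= expr0n mul0r addr0.
have := penalized_step_le x (ctail k') (step_itv (k' 0%N)).
set r : R := step_size (k' 0%N).
have r0 : 0 <= r := step_ge0 _; have r2 : r <= 2^-1 := step_le _.
have rK : r <= damp R K.
  rewrite /r; case: (k' 0%N) cl => [i|] /=; last by rewrite (ltW (damp_gt0 _ _)).
  by case: ltnP => // Ki _; apply: damp_le; rewrite ltnW// ltnS ltnW.
have : r * supnorm x <= damp R K * supnorm x by rewrite ler_wpM2r.
have : r ^+ 2 * rounding x <= r * supnorm x.
  rewrite ler_pM ?sqr_ge0 ?round_le ?(seminorm_ge0 _ seminorm_round)//.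
  by rewrite expr2 ler_piMl//; lra.
by lra.
Qed.

Lemma full_norm_attained x : exists k, full_norm x = code_norm k x.
Proof.
have [k kmax] := usc_max (@code_norm_usc x) (code_norm_le ^~ x).
exists k; apply/eqP; rewrite eq_le le_full_norm andbT.
exact: (supf_le k).
Qed.

End CodeNormUsc.

(** * Strict convexity *)

Section StrictConvexity.
Context {R : realType}.
Implicit Types (x z m : tame_fun R) (s : code) (c : clause).

Lemma le_damp_le0 (a C : R) : 0 <= C -> (forall i, a <= C * damp R i) -> a <= 0.
Proof.
move=> C0 aC; rewrite leNgt; apply/negP => a0.
have C1 : 0 < C + 1 by rewrite ltr_wpDl.
have [|i ie] := @damp_small R (a / 2 / (C + 1)); first by rewrite !divr_gt0.
have := aC i; move: ie; rewrite ler_pdivlMr// => ie.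
by have := damp_gt0 R i; lra.
Qed.

Definition cons_code (a : letter) s : code := fun i => if i is j.+1 then s j else a.

(** If the maximum is attained at [r = 0] there is no penalty: a penalty would
    grow with slope one in [r], while the other terms decrease only
    quadratically. *)
Lemma branch_norm_of_max s m : full_norm m = 1 ->
  code_norm (cons_code None s) m = 1 -> branch_norm s m = 1.
Proof.
move=> m1; rewrite /code_norm /= expr0n mul0r addr0 (_ : ctail _ = s)// => p1.
have i0 := @step_itv R None.
have l1 : branch_norm s m <= 1.
  by have := penalized_ge_branch i0 s m; rewrite expr0n subr0 mul1r p1.
have l0 := branch_norm_ge0 s m.
apply/eqP; rewrite eq_le l1 /= -subr_le0; apply: (@le_damp_le0 _ 1) => // i.
have r_itv := @step_itv R (Some i).
set r := step_size (Some i) in r_itv; have /andP[r0 r2] := r_itv.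
have rp : 0 < r := damp_gt0 R i.+1.
have pr c : clause_term r s m c <= 1.
  rewrite (le_trans (le_penalized r_itv s m c))// -[leRHS]m1.
  rewrite (le_trans _ (le_full_norm (cons_code (Some i) s) m))//.
  rewrite /code_norm (_ : ctail _ = s)// lerDl mulr_ge0 ?sqr_ge0//.
  exact: seminorm_ge0 seminorm_round.
set l := branch_norm s m in l0 l1 *.
have : 1 + r <= (1 + r) * l + (1 - (1 - r ^+ 2) * l).
  have r1 : 0 < 1 + r by lra.
  have : 1 <= l + (1 - (1 - r ^+ 2) * l) / (1 + r).
    rewrite -[leLHS]p1; apply: (supf_le Trivial) => c.
    rewrite /clause_term expr0n subr0 addr0 !mul1r lerD2l ler_pdivlMr//.
    by have := pr c; rewrite /clause_term -/l; lra.
  by move=> /(ler_wpM2l (ltW r1)); rewrite mulr1 mulrDr mulrCA divff ?gt_eqF// mulr1.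
have -> : (1 + r) * l + (1 - (1 - r ^+ 2) * l) = 1 + r * (l * (1 + r)) by ring.
rewrite lerD2l -{1}[r]mulr1 ler_pM2l// => h.
have : l * r <= r by rewrite ler_piMl.
have : r <= damp R i := damp_le R (leqnSn i).
by lra.
Qed.

Lemma clause_form_le s x c : full_norm x <= 1 -> branch_norm s x = 1 ->
  `|clause_form s c x| <= clause_bound s c.
Proof.
move=> x1 l1; have i0 := @step_itv R None.
have := le_full_norm (cons_code None s) x.
rewrite /code_norm /= expr0n mul0r addr0 (_ : ctail _ = s)// => p1.
have := le_penalized i0 s x c; rewrite /clause_term expr0n subr0 addr0 !mul1r l1 => p2.
have : clause_weight c * clause_excess s x c <= 0 by lra.
by rewrite pmulr_rle0 ?weight_gt0// /clause_excess l1 mulr1 subr_le0.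
Qed.

(** Let $d$ be the difference of the two values at the address [u]. Adding the
    certificates for opposite signs at the two ends bounds each coordinate
    $f_v$ of the midpoint by $1+\theta\varepsilon-\theta|d|/2$. As the
    supremum over $v$ is $1$ and $\theta$ does not depend on $v$, this gives
    $|d|\le 2\varepsilon$. *)
Lemma coordinates_eq s x z : full_norm x <= 1 -> full_norm z <= 1 ->
  branch_norm s x = 1 -> branch_norm s z = 1 ->
  branch_norm s (2^-1 *: (x + z)) = 1 ->
  forall u, x (branch s u) = z (branch s u).
Proof.
move=> x1 z1 lx lz lm u; apply/eqP; rewrite -subr_eq0 -normr_le0.
apply: (@le_damp_le0 _ 2) => // n.
have xf c := clause_form_le c x1 lx; have zf c := clause_form_le c z1 lz.
have data v : exists2 p, cert_data s v u n = Some p & s (step_pos n) = Some p.1.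
  have := xf (Cert v u n true); rewrite /clause_bound.
  case E : (cert_data s v u n) => [p|]; last first.
    by have := normr_ge0 (clause_form s (Cert v u n true) x); lra.
  move=> _; exists p => //; move: E; rewrite /cert_data.
  by case: (s _) => // a; case: (s _) => // d [<-].
have [[a d0] _ /= sa] := data [::].
set th := damp R a; set ep := damp R n.
have th0 : 0 < th := damp_gt0 R a.
set de := x (branch s u) - z (branch s u).
have main v : `|tame_val (2^-1 *: (x + z)) (branch s v)| <= 1 + th * ep - th * `|de| / 2.
  have [[a' d] E sa'] := data v.
  have aa' : a = a' by move: sa'; rewrite sa => -[].
  have := (xf (Cert v u n true), zf (Cert v u n true), xf (Cert v u n false), zf (Cert v u n false)).
  rewrite /clause_form /clause_bound E -aa' /cert_bound -/th -/ep expr1 expr0 mulN1r mul1r.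
  rewrite evalZ evalD /de.
  set M := Num.min _ _; move=> [[[]]]; rewrite !ler_norml.
  move=> /andP[h1 h2] /andP[h3 h4] /andP[h5 h6] /andP[h7 h8].
  (* the sign of the difference decides which two certificates are added *)
  have [d0'|d0'] := leP 0 (x (branch s u) - z (branch s u)).
    by rewrite ger0_norm//; apply/andP; split; lra.
  by rewrite ltr0_norm//; apply/andP; split; lra.
have : 1 <= 1 + th * ep - th * `|de| / 2.
  by rewrite -[leLHS]lm; apply: (supf_le [::]).
move=> h; have : th * `|de| <= th * (2 * ep) by lra.
by rewrite ler_pM2l.
Qed.

Lemma full_norm_strict x z : full_norm x = 1 -> full_norm z = 1 ->
  full_norm (2^-1 *: (x + z)) = 1 -> x = z.
Proof.
set m := _ *: _ => x1 z1 m1.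
have [k mk] := full_norm_attained m.
have k1 : code_norm k m = 1 by rewrite -mk.
have kx := le_full_norm k x; have kz := le_full_norm k z.
have kE : k = cons_code (k 0%N) (ctail k) by apply/funext => -[].
set s := ctail k in kE.
case E : (k 0%N) => [i|]; last first.
  rewrite kE E in k1 kx kz.
  have lm := branch_norm_of_max m1 k1.
  have i0 := @step_itv R None.
  have lle (y : tame_fun R) : full_norm y = 1 -> branch_norm s y <= 1.
    move=> y1; have := le_full_norm (cons_code None s) y.
    rewrite /code_norm /= expr0n mul0r addr0 (_ : ctail _ = s)// y1.
    by have := penalized_ge_branch i0 s y; rewrite expr0n subr0 mul1r; apply: le_trans.
  have := seminorm_mid x z (seminorm_branch_norm s); rewrite lm.
  have := lle _ x1; have := lle _ z1 => lz lx lxz.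
  have {}lx : branch_norm s x = 1 by lra.
  have {}lz : branch_norm s z = 1 by lra.
  have x1' : full_norm x <= 1 by rewrite x1.
  have z1' : full_norm z <= 1 by rewrite z1.
  apply: tame_ext => t.
  have stem (y : tame_fun R) : full_norm y <= 1 -> branch_norm s y = 1 -> y t = y (take (meet s t) t).
    move=> y1 ly; apply/eqP; rewrite -subr_eq0 -normr_le0.
    exact: (clause_form_le (Stem t) y1 ly).
  by rewrite stem// [RHS]stem// take_meet (coordinates_eq x1' z1' lx lz lm).
have r_itv := step_itv (R := R) (k 0%N).
have := seminorm_mid x z (seminorm_penalized r_itv s); rewrite -/m.
move: k1 kx kz; rewrite /code_norm -/s x1 z1.
set r := step_size (k 0%N) in r_itv * => k1 kx kz pm.
have r0 : 0 < r ^+ 2 by rewrite exprn_gt0// /r E damp_gt0.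
have : r ^+ 2 * (rounding x + rounding z) <= r ^+ 2 * (2 * rounding m) by lra.
rewrite ler_pM2l// => /round_strict xz.
have := congr1 full_norm xz.
rewrite !seminorm_full_norm.2 x1 z1 !mulr1 !ger0_norm ?supnorm_ge0// => S.
have S0 : supnorm x != 0.
  apply/eqP => /supnorm_eq0 x0; move: x1.
  by rewrite x0 (seminorm0 seminorm_full_norm) => /eqP; rewrite eq_sym oner_eq0.
by apply: (scalerI S0); rewrite xz S.
Qed.

End StrictConvexity.

(** * Completeness and separability *)

Section FullNorm.
Variable R : realType.

Lemma full_norm_eq0 (x : tame_fun R) : full_norm x = 0 -> x = 0.
Proof.
move=> x0; apply: supnorm_eq0; apply/eqP; rewrite eq_le supnorm_ge0 andbT.
by rewrite -x0 supnorm_le_full.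
Qed.

HB.instance Definition _ := Lmodule_isNormed.Build R (tame_fun R)
  seminorm_full_norm.1 seminorm_full_norm.2 full_norm_eq0.

Lemma tame_normE (x : tame_fun R) : `|x| = full_norm x.
Proof. by []. Qed.

Lemma eval_le_norm (x : tame_fun R) t : `|x t| <= `|x|.
Proof. by rewrite tame_normE (le_trans (eval_le x t))// supnorm_le_full. Qed.

Lemma norm_le_eval (x : tame_fun R) c : (forall t, `|x t| <= c) -> `|x| <= 2 * c.
Proof.
move=> xc; rewrite tame_normE (le_trans (full_norm_le x))// ler_wpM2l//.
exact: supnorm_le.
Qed.

Lemma tame_limit (l : node -> R) :
  (forall e, 0 < e -> exists x : tame_fun R, forall t, `|x t - l t| <= e) -> tame l.
Proof.
move=> ll e e0; have e3 : 0 < e / 3 by rewrite divr_gt0.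
have [x xl] := ll _ e3; have [K xK] := tame_eval x e3; exists K => t.
have := xl t; have := xl (trunc K t); have := xK t.
rewrite [in X in _ -> _ -> X -> _]distrC => h1 h2 h3.
rewrite (le_trans (ler_distD (x t) _ _))//.
rewrite (le_trans (lerD (lexx _) (ler_distD (x (trunc K t)) _ _)))//.
by lra.
Qed.

Lemma tame_complete (F : set_system (tame_fun R)) : ProperFilter F -> cauchy F -> cvg F.
Proof.
move=> FF Fc.
have /choice[x Fx] : forall n, exists x : tame_fun R, F (ball x (damp R n)).
  by move=> n; apply: (proj1 (cauchyP F) Fc); exact: damp_gt0.
have xy n m t : x n t - damp R n <= x m t + damp R m.
  have [y [/= yn ym]] := filter_ex (filterI (Fx n) (Fx m)).
  move: yn ym; rewrite -!ball_normE /= => yn ym.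
  have := le_lt_trans (eval_le_norm (x n - y) t) yn.
  have := le_lt_trans (eval_le_norm (x m - y) t) ym.
  rewrite !evalD !evalN !ltr_distl => /andP[h2 _] /andP[_ h1].
  by rewrite lerBlDr (le_trans (ltW h1))// lerD2r -lerBlDr ltW.
(* the lower bounds for the limit at t supplied by the approximations x n *)
pose l t := supf (fun n => x n t - damp R n).
have xl n t : `|x n t - l t| <= damp R n.
  rewrite ler_distl; apply/andP; split.
    by rewrite lerBlDr; apply: (supf_le 0%N) => m; exact: xy.
  rewrite -lerBlDr; apply: (@le_supf _ _ (fun n => x n t - damp R n) (x 0%N t + damp R 0%N)).
  by move=> m; exact: xy.
have tl : tame l.
  apply: tame_limit => e e0; have [n ne] := damp_small e0.
  by exists (x n) => t; exact: le_trans (xl n t) ne.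
apply: (cvgP (tame_of tl)); apply/cvgrPdist_lt => e e0.
have e4 : 0 < e / 4 by rewrite divr_gt0.
have [n ne] := damp_small e4.
apply: filterS (Fx n) => y; rewrite -ball_normE /= => xny.
rewrite (le_lt_trans (ler_distD (x n) (tame_of tl) y))//.
have h : `|tame_of tl - x n| <= 2 * damp R n.
  by apply: norm_le_eval => t; rewrite evalD evalN mk_tameE distrC.
by rewrite (le_lt_trans (lerD h (ltW xny)))//; lra.
Qed.

HB.instance Definition _ := Uniform_isComplete.Build (tame_fun R) tame_complete.

Lemma tame_separable : separable (tame_fun R).
Proof.
pose lookup (l : seq (node * rat)) (t : node) : R :=
  ratr (nth 0 (unzip2 l) (index t (unzip1 l))).
have tl (K : nat) l : tame (fun t => lookup l (trunc K t)).
  move=> e e0; exists K => t; rewrite trunc_trunc minnn subrr normr0.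
  exact: ltW.
pose d (p : nat * seq (node * rat)) : tame_fun R := tame_of (tl p.1 p.2).
exists (range d).
  apply: sub_countable (card_image_le d setT) _; exact: countableP.
move=> O [x Ox] Oo.
have [e e0 xe] : exists2 e : R, 0 < e & ball x e `<=` O.
  by apply/nbhs_ballP; exact: open_nbhs_nbhs.
have e8 : 0 < e / 8 by rewrite divr_gt0.
have [K xK] := tame_eval x e8; have [s sP] := trunc_finite K.
pose q (t : node) : rat := xget 0 [set q | `|x t - ratr q| <= e / 8].
have qP t : `|x t - ratr (q t)| <= e / 8.
  rewrite /q; case: xgetP => [//|nq]; exfalso.
  have [r /andP[r1 r2]] : exists r : rat, x t - e / 8 < ratr r < x t + e / 8.
    have := @rat_in_itvoo R (x t - e / 8) (x t + e / 8).
    case; first lra.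
    by move=> r; rewrite in_itv /=; exists r.
  by apply: (nq r); rewrite /= ler_distl; apply/andP; split; lra.
exists (d (K, [seq (t, q t) | t <- s])); split; last by exists (K, [seq (t, q t) | t <- s]).
apply: xe; rewrite -ball_normE /=.
suff : `|x - d (K, [seq (t, q t) | t <- s])| <= 2 * (e / 4) by lra.
apply: norm_le_eval => t; rewrite evalD evalN mk_tameE /= /lookup.
have -> : unzip1 [seq (t, q t) | t <- s] = s by rewrite /unzip1 -map_comp map_id.
have -> : unzip2 [seq (t, q t) | t <- s] = map q s by rewrite /unzip2 -map_comp.
rewrite (nth_map [::]) ?index_mem// nth_index//.
rewrite (le_trans (ler_distD (x (trunc K t)) _ _))//.
by have := xK t; have := qP (trunc K t); lra.
Qed.

Lemma tame_strictly_convex : strictly_convex (tame_fun R).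
Proof.
move=> x y xy.
have sph t : 0 <= t <= 1 -> `|(1 - t) *: x + t *: y| = 1.
  by move=> t01; apply: xy; exists t => //=; rewrite in_itv.
apply: full_norm_strict; rewrite -tame_normE.
- by have := sph 0; rewrite subr0 scale1r scale0r addr0; apply; rewrite lexx ler01.
- by have := sph 1; rewrite subrr scale1r scale0r add0r; apply; rewrite lexx ler01.
- have := sph 2^-1; rewrite (_ : 1 - 2^-1 = 2^-1 :> R) -?scalerDr; last by field.
  by apply; apply/andP; split; lra.
Qed.
End FullNorm.

(** * Certificates of uniform convexity *)

Section Certificates.
Context {R : realType} (Y : normedModType R) (g : seq bool -> Y -> R).
Hypothesis gT : functional_tree g.
Implicit Types (y z : Y) (u v : seq bool).

Lemma treeZ u a y : g u (a *: y) = a * g u y.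
Proof.
have g0 : g u 0 = 0.
  by apply/eqP; rewrite -normr_le0 (le_trans (tree_damped gT u 0))// normr0 mulr0.
by have := tree_linear gT u a y 0; rewrite g0 !addr0.
Qed.

Lemma treeN u y : g u (- y) = - g u y.
Proof. by rewrite -scaleN1r treeZ mulN1r. Qed.

Lemma tree_le u y : `|g u y| <= `|y|.
Proof.
by rewrite (le_trans (tree_damped gT u y))// ler_piMl// lerBlDr lerDl ltW// damp_gt0.
Qed.

Variables (a n : nat).
Let th : R := damp R a.
Let ep : R := damp R n.
Hypothesis Yconvex : forall y z, `|y| = 1 -> `|z| = 1 -> ep <= `|y - z| ->
  `|2^-1 *: (y + z)| <= 1 - th.

(** Either the two vectors are at distance less than [ep], and the
    perturbation contributes at most [th * ep], or the midpoint is short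
    enough to absorb it. *)
Lemma smoothness_unit v u y z : `|y| = 1 -> `|z| = 1 ->
  (g v y + th * g u y) + (g v z - th * g u z) <= 2 + th * ep.
Proof.
move=> y1 z1; have th0 : 0 < th := damp_gt0 R a; have ep0 : 0 < ep := damp_gt0 R n.
have te : 0 <= th * ep by rewrite mulr_ge0// ltW.
have vE : g v y + g v z = g v (y + z).
  by have := tree_linear gT v 1 y z; rewrite !scale1r => ->.
have uE : g u y - g u z = g u (y - z).
  by have := tree_linear gT u 1 y (- z); rewrite !scale1r treeN => ->.
have -> : g v y + th * g u y + (g v z - th * g u z) = g v (y + z) + th * g u (y - z).
  by rewrite -vE -uE; ring.
have hv := le_trans (ler_norm _) (tree_le v (y + z)).
have hu := le_trans (ler_norm _) (tree_le u (y - z)).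
have yz2 : `|y + z| <= 2 by rewrite (le_trans (ler_normD _ _))// y1 z1.
have yz2' : `|y - z| <= 2 by rewrite (le_trans (ler_normB _ _))// y1 z1.
have hu' := ler_wpM2l (ltW th0) hu.
have [far|close] := leP ep `|y - z|.
  have := Yconvex y1 z1 far; rewrite normrZ ger0_norm ?invr_ge0// => h.
  by have := ler_wpM2l (ltW th0) yz2'; lra.
by have := ler_wpM2l (ltW th0) (ltW close); lra.
Qed.

Lemma smoothness v u y z : 0 < `|y| -> 0 < `|z| ->
  (g v y + th * g u y) / `|y| + (g v z - th * g u z) / `|z| <= 2 + th * ep.
Proof.
move=> y0 z0.
have nE (w : Y) : 0 < `|w| -> `| `|w|^-1 *: w | = 1.
  by move=> w0; rewrite normrZ normfV normr_id mulVf// gt_eqF.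
have := smoothness_unit v u (nE _ y0) (nE _ z0); rewrite !treeZ.
by rewrite !mulrDl mulNr ![_ / `|_|]mulrC ![`|_|^-1 * (th * _)]mulrCA.
Qed.

(** The least multiple [d * (th * ep)] that bounds the first functional
    exceeds its norm by at most [th * ep]; the sum of the two norms is at most
    [2 + th * ep], which leaves [2 + 2 * (th * ep) - d * (th * ep)] for the
    second. *)
Lemma certificate_exists v u : exists d, forall y (b : bool),
  `|g v y + (-1) ^+ b * th * g u y| <= cert_bound a d n b * `|y|.
Proof.
have th0 : 0 < th := damp_gt0 R a; have ep0 : 0 < ep := damp_gt0 R n.
have th1 : th <= 1 := damp_le1 R a; have ep1 : ep <= 1 := damp_le1 R n.
have te : 0 < th * ep by rewrite mulr_gt0.
have te1 : th * ep <= 1 by rewrite mulr_ile1// ltW.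
have [[z0 z00]|triv] := pselect (exists z, 0 < `|z|); last first.
  have yE y : `|y| = 0.
    by apply/eqP; rewrite eq_le normr_ge0 andbT leNgt; apply/negP => y0; apply: triv; exists y.
  have gE w y : g w y = 0.
    by apply/eqP; rewrite -normr_le0 -(yE y) tree_le.
  by exists 0%N => y b; rewrite !gE yE !mulr0 addr0 normr0.
pose up d := `[< forall y, g v y + th * g u y <= d%:R * (th * ep) * `|y| >].
have le2 y : g v y + th * g u y <= 2 * `|y|.
  have := le_trans (ler_norm _) (tree_le v y).
  have := ler_pM (ltW th0) (normr_ge0 _) th1 (tree_le u y).
  by rewrite -[X in X * _](ger0_norm (ltW th0)) -normrM; have := ler_norm (th * g u y); lra.
have exup : exists d, up d.
  exists (Num.truncn (2 / (th * ep))).+1; apply/asboolP => y.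
  rewrite (le_trans (le2 y))// ler_wpM2r// -ler_pdivrMr//.
  exact: ltW (truncnS_gt _).
pose d := ex_minn exup; exists d.
have dP y : g v y + th * g u y <= d%:R * (th * ep) * `|y|.
  by rewrite /d; case: ex_minnP => m /asboolP.
(* by minimality of d the preceding multiple fails somewhere; for d = 0 use a sign *)
have near_extremal : exists2 y, 0 < `|y| & (d%:R - 1) * (th * ep) * `|y| <= g v y + th * g u y.
  rewrite /d; case: ex_minnP => -[_ _|m _ mmin].
    have [z0p|z0n] := leP 0 (g v z0 + th * g u z0).
      exists z0 => //; rewrite (le_trans _ z0p)// sub0r mulN1r mulNr oppr_le0.
      by rewrite mulr_ge0// ltW.
    exists (- z0); first by rewrite normrN.
    rewrite !treeN sub0r mulN1r mulNr normrN.
    by have := mulr_ge0 (ltW te) (ltW z00); lra.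
  have /asboolPn/existsNP[y /negP] : ~~ up m.
    by apply/negP => /mmin; rewrite ltnn.
  rewrite -ltNge => ylt; exists y; last by rewrite -natr1 addrK ltW.
  rewrite normr_gt0; apply/eqP => y0; move: ylt.
  by rewrite y0 normr0 mulr0 -(scale0r (0 : Y)) !treeZ !mul0r mulr0 addr0 ltxx.
have [y0 y00 y0P] := near_extremal.
have d3 : d%:R * (th * ep) <= 3.
  have := le_trans y0P (le2 y0); rewrite ler_pM2r//.
  by lra.
have dN z : g v z - th * g u z <= (2 + 2 * (th * ep) - d%:R * (th * ep)) * `|z|.
  have [z1|] := ltP 0 `|z|; last first.
    rewrite normr_le0 => /eqP ->.
    by rewrite normr0 -(scale0r (0 : Y)) !treeZ !mul0r !mulr0 subr0.
  rewrite -ler_pdivrMr//; have := smoothness v u y00 z1.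
  have : (d%:R - 1) * (th * ep) <= (g v y0 + th * g u y0) / `|y0| by rewrite ler_pdivlMr.
  by lra.
move=> y b; rewrite /cert_bound -/th -/ep (min_idPl d3).
rewrite ler_norml; apply/andP; case: b; rewrite ?expr1 ?expr0 ?mulN1r ?mul1r ?mulNr; split.
- by have := dN (- y); rewrite !treeN normrN; lra.
- exact: dN.
- by have := dP (- y); rewrite !treeN normrN; lra.
- exact: dP.
Qed.

End Certificates.

(** * The isometric embedding *)

Section Embedding.
Context {R : realType} (Y : normedModType R) (g : seq bool -> Y -> R).
Hypothesis gT : functional_tree g.
Variable tau : code.
Hypothesis tau_some : forall i, tau i != None.
Implicit Types (y z : Y) (u v : seq bool) (t : node) (s : code) (c : clause).

Definition spread_value y t : R := g (take (meet tau t) (unzip2 t)) y.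

Lemma spread_tame y : tame (spread_value y).
Proof.
move=> e e0; have [D gD] := tree_cauchy gT y e0.
have [K [DK Ktau]] := clip_bound tau D; exists K => t.
have /andP[k1 k2] := meet_trunc t DK Ktau; rewrite /spread_value.
set k := meet tau t in k1 k2 *; set k' := meet tau (trunc K t) in k1 k2 *.
have kK : (k' <= K)%N.
  by rewrite (leq_trans (meet_le _ _))// size_map size_take_min geq_minl.
have -> : take k' (unzip2 (trunc K t)) = take k' (take k (unzip2 t)).
  rewrite take_takel// /unzip2 /trunc -map_comp.
  rewrite (eq_map (_ : _ =1 snd))//.
  by rewrite map_take take_takel.
have [Dk'|k'D] := leqP D k'; first exact: gD.
have -> : k' = k by apply/eqP; rewrite eqn_leq k2; move: k1 k'D; lia.
by rewrite take_takel// subrr normr0 ltW.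
Qed.

Definition embed y : tame_fun R := tame_of (spread_tame y).

Lemma embed_linear : linear embed.
Proof.
move=> a y z; apply: tame_ext => t; rewrite evalD evalZ !mk_tameE /spread_value.
exact: (tree_linear gT).
Qed.

Lemma embed_supnorm y : supnorm (embed y) <= `|y|.
Proof. by apply: supnorm_le => t; exact: tree_le. Qed.

Lemma embed_branch y v : embed y (branch tau v) = g v y.
Proof.
by rewrite mk_tameE /spread_value branch_bits meet_branch_same// take_size.
Qed.

Lemma embed_branch_off k s y : (forall i, (i < k)%N -> tau i = s i) ->
  tau k != s k -> branch_norm s (embed y) <= (1 - damp R k) * `|y|.
Proof.
move=> ts tks; apply: (supf_le [::]) => v.
rewrite mk_tameE /spread_value branch_bits (meet_branch v ts tks tau_some).
rewrite (le_trans (tree_damped gT _ y))// ler_wpM2r// lerB// damp_le//.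
by rewrite size_take_min geq_min geq_minl.
Qed.

Hypothesis tau_cert : forall v u n b y, exists2 p, cert_data tau v u n = Some p &
  `|g v y + (-1) ^+ (b : bool) * damp R p.1 * g u y| <= cert_bound p.1 p.2 n b * `|y|.

(** Clauses decided by the common prefix of [s] and [tau] hold for the
    representation of [y], with the norm of [y] in place of the branch norm.
    *)
Lemma embed_clause_form L s y c : (forall i, (i < L)%N -> tau i = s i) ->
  (clause_depth c <= L)%N -> `|clause_form s c (embed y)| <= clause_bound s c * `|y|.
Proof.
move=> ts; case: c => [|v u n b|t] cL.
- by rewrite /= normr0 mul0r.
- rewrite /= !geq_max gtn_max in cL; have /and3P[/andP[p1 p2] vL uL] := cL.
  have [[a d] E cert] := tau_cert v u n b y.
  have Es : cert_data s v u n = Some (a, d).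
    by rewrite -E /cert_data !ts.
  rewrite /clause_form /clause_bound Es (_ : branch s v = branch tau v); last first.
    by apply: eq_branch => i iv; rewrite ts// (leq_trans iv).
  rewrite (_ : branch s u = branch tau u); last first.
    by apply: eq_branch => i iv; rewrite ts// (leq_trans iv).
  by rewrite !embed_branch.
- rewrite /= geq_max in cL; have /andP[tL _] := cL.
  rewrite mul0r normr_le0 subr_eq0; apply/eqP.
  rewrite /= /spread_value -(meet_agree ts tL) meet_take minnn.
  by rewrite /unzip2 map_take take_takel.
Qed.

(** A clause that holds with the norm of [y] is violated by at most four times
    the gap between that norm and the branch norm, and has weight at most [1 /
    16]. Any other clause is deeper than the first disagreement of [s] with
    [tau], so its weight is small compared with the gap which the damping
    creates. *)
Lemma excess_slack s y c :
  branch_norm s (embed y) + 2 * (clause_weight c * clause_excess s (embed y) c) <= `|y|.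
Proof.
have S1 := embed_supnorm y.
have l1 := le_trans (branch_norm_le s (embed y)) S1.
have w0 := ltW (weight_gt0 (R := R) c); have w1 := weight_le (R := R) c.
have good L : (forall i, (i < L)%N -> tau i = s i) -> (clause_depth c <= L)%N ->
    branch_norm s (embed y) + 2 * (clause_weight c * clause_excess s (embed y) c) <= `|y|.
  move=> ts cL; have := embed_clause_form y ts cL => f1.
  have /andP[_ b4] := bound_itv (R := R) s c.
  have : clause_excess s (embed y) c <= 4 * (`|y| - branch_norm s (embed y)).
    have : clause_bound s c * (`|y| - branch_norm s (embed y)) <=
        4 * (`|y| - branch_norm s (embed y)) by rewrite ler_wpM2r// subr_ge0.
    by rewrite /clause_excess; lra.
  move=> /weight_excess_le; rewrite mulr_ge0// ?subr_ge0// => /(_ isT).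
  by lra.
have [ts|/existsNP[i0 /eqP i0P]] := pselect (forall i, tau i = s i).
  by apply: (good (clause_depth c)).
have ex : exists k, tau k != s k by exists i0.
pose k := ex_minn ex.
have [kP kmin] : tau k != s k /\ forall i, (i < k)%N -> tau i = s i.
  rewrite /k; case: ex_minnP => m mP mmin; split=> // i im.
  by apply/eqP; apply: contraTT im => /mmin; rewrite -leqNgt.
have [ck|kc] := leqP (clause_depth c) k; first exact: good kmin ck.
have := embed_branch_off y kmin kP.
have : clause_weight c * clause_excess s (embed y) c <= clause_weight c * (6 * `|y|).
  rewrite ler_wpM2l// (le_trans (excess_le _ _ _))// ler_wpM2l//.
have : damp R (clause_depth c) * `|y| <= damp R k * `|y|.
  by rewrite ler_wpM2r// damp_le// ltnW.
rewrite /clause_weight => h1 h2 h3; have := mulr_ge0 (ltW (damp_gt0 R k)) (normr_ge0 y).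
by lra.
Qed.

Lemma embed_isometry y : `|embed y| = `|y|.
Proof.
apply/eqP; rewrite eq_le; apply/andP; split; last first.
  rewrite leNgt; apply/negP => lt.
  have e0 : 0 < (`|y| - `|embed y|) / 2 by rewrite divr_gt0// subr_gt0.
  have [u gu] := tree_norming gT y e0.
  have := eval_le_norm (embed y) (branch tau u); rewrite embed_branch => gu'.
  have := le_trans gu gu'; move: lt; move: `|y| `|embed y| => p q; lra.
rewrite tame_normE; apply: (supf_le (fun _ => None)) => k.
rewrite /code_norm; have r_itv := step_itv (R := R) (k 0%N).
set r := step_size _ in r_itv *; set s := ctail k; have /andP[r0 r2] := r_itv.
have rr : r ^+ 2 <= 4^-1.
  by rewrite expr2 (le_trans (ler_pM r0 r0 r2 r2))//; lra.
have hh : r ^+ 2 * rounding (embed y) <= r ^+ 2 * `|y|.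
  by rewrite ler_wpM2l ?sqr_ge0// (le_trans (round_le _))// embed_supnorm.
suff : penalized r s (embed y) <= (1 - r ^+ 2) * `|y| by lra.
apply: (supf_le Trivial) => c; rewrite /clause_term.
have := excess_slack s y c.
have := le_trans (branch_norm_le s (embed y)) (embed_supnorm y).
set l := branch_norm _ _; set q := clause_weight c * _ => ly lq.
have [q0|q0] := leP q 0.
  have : (1 + r) * q <= 0 by rewrite mulr_ge0_le0// addr_ge0.
  have : (1 - r ^+ 2) * l <= (1 - r ^+ 2) * `|y| by rewrite ler_wpM2l//; lra.
  by lra.
have : (1 + r) * q <= (3 / 2) * q by rewrite ler_wpM2r ?(ltW q0)//; lra.
have : (3 / 4) * (`|y| - l) <= (1 - r ^+ 2) * (`|y| - l).
  by rewrite ler_wpM2r ?subr_ge0//; lra.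
by lra.
Qed.

End Embedding.

Lemma uniformly_convex_embeds (R : realType) (Y : normedModType R) :
  separable Y -> uniformly_convex Y -> isometrically_embeds Y (tame_fun R).
Proof.
move=> /functional_tree_exists[g gT] Yuc.
have /choice[a aP] : forall n, exists a, forall y z : Y, `|y| = 1 -> `|z| = 1 ->
    damp R n <= `|y - z| -> `|2^-1 *: (y + z)| <= 1 - damp R a.
  move=> n; have [d d0 dP] := Yuc _ (damp_gt0 R n).
  have [a ad] := damp_small d0; exists a => y z y1 z1 yz.
  by rewrite (le_trans (dP y z y1 z1 yz))// lerB.
have /choice[d dP] : forall p : seq bool * seq bool * nat, exists d, forall y (b : bool),
    `|g p.1.1 y + (-1) ^+ b * damp R (a p.2) * g p.1.2 y|
      <= cert_bound (a p.2) d p.2 b * `|y|.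
  by move=> [[v u] n]; exact: (certificate_exists gT (aP n) v u).
pose tau : code := fun i =>
  if unpickle i is Some q then
    match q : nat + (seq bool * seq bool * nat) with
    | inl n => Some (a n) | inr p => Some (d p) end
  else Some 0%N.
have tau_some i : tau i != None.
  by rewrite /tau; case: unpickle => [[]|].
have tau_cert v u n (b : bool) y : exists2 p, cert_data tau v u n = Some p &
    `|g v y + (-1) ^+ b * damp R p.1 * g u y| <= cert_bound p.1 p.2 n b * `|y|.
  exists (a n, d (v, u, n)); last exact: (dP (v, u, n)).
  by rewrite /cert_data /tau /step_pos /bound_pos !pickleK.
pose J : Y -> tame_fun R := embed gT tau.
pose JL := GRing.isLinear.Build R Y (tame_fun R) *:%R J (embed_linear gT tau).
pose f : {linear Y -> tame_fun R} := HB.pack J JL.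
exists f => y; exact: (embed_isometry gT tau_some tau_cert y).
Qed.

Theorem corollary1p4 (R : realType) :
  exists X : completeNormedModType R,
    [/\ separable X, strictly_convex X &
        isometrically_universal X
          (fun Y : completeNormedModType R => separable Y /\ uniformly_convex Y)].
Proof.
exists (tame_fun R); split.
- exact: tame_separable.
- exact: tame_strictly_convex.
- by move=> Y [Ys Yu]; exact: uniformly_convex_embeds.
Qed.
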